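(* Let $A$ be a noetherian commutative ring in which $2$ is invertible, let $n\ge1$, let $f(u)=\sum_{i=0}^na_{2n-2i}u^{2i}\in A[u]$ with $a_0=1$, let $B$ be the signed splitting ring of $f$, and let $\Delta\in A$ and $V(\Delta,\partial\Delta)\subset\operatorname{Spec}(A)$ be as in the context. Suppose that (a) $A$ is normal, (b) $\Delta$ is a non-zerodivisor, (c) $V(\Delta,\partial\Delta)$ has codimension $\ge2$. Then $\Delta$ is squarefree and $B$ is normal.
   Context: The signed splitting ring is $B=\operatorname{SSplit}_A(f)=A[\eta_1,\dots,\eta_n]/I$, where $I$ is generated by equating coefficients in $f(u)=\prod_{i=1}^n(u^2-\eta_i^2)$, i.e. by $a_{2i}-(-1)^ie_i(\eta_1^2,\dots,\eta_n^2)$, $1\le i\le n$ ($e_i$ = elementary symmetric polynomial). Let $\tilde f(v)=\sum_{i=0}^na_{2n-2i}v^i$ and let $\tilde\Delta\in A$ be its discriminant. Put $\Delta=(-1)^n4^na_{2n}\tilde\Delta\in A$; in $B$ it equals $4^n\eta_1^2\cdots\eta_n^2\prod_{i<j}(\eta_i^2-\eta_j^2)^2$. $V(\Delta,\partial\Delta)$ is the set of $x\in\operatorname{Spec}(A)$ such that the image of $\Delta$ in the local ring $A_x$ lies in $\mathfrak m_x^2$, where $\mathfrak m_x$ is the maximal ideal of $A_x$. An element $h$ of a normal ring $R$ is squarefree if $v_{\mathfrak p}(h)\in\{0,1\}$ for all height one primes $\mathfrak p$ of $R$, $v_{\mathfrak p}$ being the associated valuation. A subset of $\operatorname{Spec}(A)$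 has codimension $\ge c$ if all primes it contains have height $\ge c$. *)

(* Defs.v *)
From HB Require Import structures.
From mathcomp Require Import all_boot all_order all_algebra generic_quotient.
From mathcomp Require Import mpoly ring.
From mathcomp Require Import boolp classical_sets.

Set Implicit Arguments.
Unset Strict Implicit.
Unset Printing Implicit Defensive.

Import Order.TTheory GRing.Theory Num.Theory.
Local Open Scope classical_set_scope.
Local Open Scope quotient_scope.
Local Open Scope ring_scope.

(* Rings are comPzRingType (possibly zero) where possible, so that a quotient
   ring can be formed without proving it nonzero. *)

Section Ideals.
Variable R : comPzRingType.

Definition is_ideal (I : set R) : Prop :=
  [/\ I 0, forall x y, I x -> I y -> I (x + y) & forall a x, I x -> I (a * x)].

Record ideal := Ideal { ideal_set :> set R; idealP : is_ideal ideal_set }.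

Definition is_prime (P : set R) : Prop :=
  [/\ is_ideal P, ~ P 1 & forall x y, P (x * y) -> P x \/ P y].

Record spec := Spec { prime_set :> set R; prime_setP : is_prime prime_set }.

Definition idealgen_set (G : set R) : set R :=
  [set x | exists m (c g : 'I_m -> R),
     (forall i, G (g i)) /\ x = \sum_(i < m) c i * g i].

Lemma idealgenP (G : set R) : is_ideal (idealgen_set G).
Proof.
split=> [|_ _ [m [c [g [Gg ->]]]] [k [d [h [Gh ->]]]]|a _ [m [c [g [Gg ->]]]]].
- exists 0%N, (fun=> 0), (fun=> 0).
  by split=> [[]//|]; rewrite big_ord0.
- exists (m + k)%N.
  exists (fun i => match split i with inl j => c j | inr j => d j end).
  exists (fun i => match split i with inl j => g j | inr j => h j end).
  split=> [i|]; first by case: (split i).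
  by rewrite big_split_ord; congr (_ + _); apply: eq_bigr => i _;
    rewrite ?(unsplitK (inl i)) ?(unsplitK (inr i)).
- exists m, (fun i => a * c i), g; split=> //.
  by rewrite mulr_sumr; apply: eq_bigr => i _; rewrite mulrA.
Qed.

Definition idealgen (G : set R) : ideal := Ideal (idealgenP G).

Definition ideal_mul (I J : set R) : ideal :=
  idealgen [set x | exists a b, [/\ I a, J b & x = a * b]].

Definition noetherian : Prop :=
  forall I : ideal, exists (m : nat) (g : 'I_m -> R), idealgen (range g) = I :> set R.

Definition height_ge (P : spec) (k : nat) : Prop :=
  exists C : nat -> spec,
    C k = P /\ forall i, (i < k)%N -> (C i : set R) `<` (C i.+1 : set R).

Definition height_eq (P : spec) (k : nat) : Prop :=
  height_ge P k /\ ~ height_ge P k.+1.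

Definition codim_ge (Z : set spec) (c : nat) : Prop :=
  forall P, Z P -> height_ge P c.

Definition nonzerodiv (s : R) : Prop := forall x, s * x = 0 -> x = 0.

(* In a local ring the nonunits form the maximal ideal. *)
Definition nonunits : set R := [set x | ~ exists y, x * y = 1].

End Ideals.

(* MathComp's ring_quotient puts a ring structure on {quot I} only when I is
   proper in a nonzero ring; here I may be any ideal. *)

Section QuotientRing.
Variables (R : comPzRingType) (I : ideal R).

Definition ideal_pred : {pred R} := fun x => `[< ideal_set I x >].

Fact ideal_pred_zmod_closed : zmod_closed ideal_pred.
Proof.
have [I0 ID IM] := idealP I.
split=> [|x y /asboolP Ix /asboolP Iy]; apply/asboolP => //.
by apply: ID => //; rewrite -mulN1r; apply: IM.
Qed.
HB.instance Definition _ :=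
  GRing.isZmodClosed.Build R ideal_pred ideal_pred_zmod_closed.

Definition quotring := Quotient.quot ideal_pred.
HB.instance Definition _ := GRing.Zmodule.on quotring.
HB.instance Definition _ := EqQuotient.on quotring.

Definition quotring_one : quotring := \pi_quotring 1.
Definition quotring_mul (x y : quotring) : quotring :=
  \pi_quotring (repr x * repr y).

Lemma quotring_eqP (x y : R) : \pi_quotring x = \pi_quotring y <-> ideal_set I (x - y).
Proof.
split=> [/eqP|Ixy]; first by rewrite -Quotient.idealrBE => /asboolP.
by apply/eqP; rewrite -Quotient.idealrBE; apply/asboolP.
Qed.

Lemma quotring_piM (x y : R) :
  \pi_quotring (x * y) = quotring_mul (\pi_quotring x) (\pi_quotring y).
Proof.
have [_ ID IM] := idealP I.
apply/quotring_eqP; set x' := repr _; set y' := repr _.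
have Ix : ideal_set I (x - x') by apply/quotring_eqP; rewrite reprK.
have Iy : ideal_set I (y - y') by apply/quotring_eqP; rewrite reprK.
have -> : x * y - x' * y' = y * (x - x') + x' * (y - y').
  by rewrite !mulrBr addrA (mulrC y x) (mulrC y x') addrNK.
by apply: ID; apply: IM.
Qed.

Lemma quotringP (x : quotring) : exists r, x = \pi_quotring r.
Proof. by exists (repr x); rewrite reprK. Qed.

Fact quotring_mulA : associative quotring_mul.
Proof.
move=> x y z; have [r ->] := quotringP x; have [s ->] := quotringP y.
have [t ->] := quotringP z.
by rewrite -(quotring_piM s) -quotring_piM -(quotring_piM r) -quotring_piM mulrA.
Qed.
Fact quotring_mulC : commutative quotring_mul.
Proof.
move=> x y; have [r ->] := quotringP x; have [s ->] := quotringP y.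
by rewrite -(quotring_piM r) -(quotring_piM s) mulrC.
Qed.
Fact quotring_mul1 : left_id quotring_one quotring_mul.
Proof.
by move=> x; have [r ->] := quotringP x; rewrite -quotring_piM mul1r.
Qed.
Fact quotring_mulDl : left_distributive quotring_mul +%R.
Proof.
move=> x y z; have [r ->] := quotringP x; have [s ->] := quotringP y.
have [t ->] := quotringP z.
have piD (p q : R) : \pi_quotring p + \pi_quotring q = \pi_quotring (p + q).
  by rewrite -[LHS]/(Quotient.add _ _) -Quotient.pi_add.
by rewrite piD -(quotring_piM r) -(quotring_piM s) -quotring_piM piD mulrDl.
Qed.

HB.instance Definition _ := GRing.Zmodule_isComPzRing.Build quotring
  quotring_mulA quotring_mulC quotring_mul1 quotring_mulDl.

End QuotientRing.

(* Excluding 0 from S makes S^-1 R a nonzero ring. *)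

Record multset (R : comPzRingType) := MultSet {
  mult_set :> set R;
  multset1 : mult_set 1;
  multsetM : forall s t, mult_set s -> mult_set t -> mult_set (s * t);
  multset0 : ~ mult_set 0 }.

Section Localization.
Variables (R : comPzRingType) (S : multset R).

Definition frac_pair := {x : R * R | `[< mult_set S x.2 >]}.

Definition mkfrac (r s : R) (Ss : mult_set S s) : frac_pair :=
  exist (fun x : R * R => `[< mult_set S x.2 >]) (r, s) (asboolT Ss).

Notation num x := (val x).1.
Notation den x := (val x).2.

Lemma denP (x : frac_pair) : mult_set S (den x).
Proof. by case: x => -[r s] /= /asboolP. Qed.

Definition frac_equiv (x y : frac_pair) : bool :=
  `[< exists2 u, mult_set S u & u * (num x * den y) = u * (num y * den x) >].

Fact frac_equiv_refl : reflexive frac_equiv.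
Proof. by move=> x; apply/asboolP; exists 1 => //; apply: multset1. Qed.
Fact frac_equiv_sym : ssrbool.symmetric frac_equiv.
Proof.
by move=> x y; apply/asboolP/asboolP => -[u Su e]; exists u.
Qed.
Fact frac_equiv_trans : transitive frac_equiv.
Proof.
move=> y x z /asboolP[u Su e] /asboolP[v Sv e']; apply/asboolP.
exists (u * v * den y); first by do 2?apply: multsetM => //; apply: denP.
have -> : u * v * den y * (num x * den z) =
          v * den z * (u * (num x * den y)) by ring.
rewrite e.
have -> : v * den z * (u * (num y * den x)) =
          u * den x * (v * (num y * den z)) by ring.
by rewrite e'; ring.
Qed.

Canonical frac_equivRel :=
  EquivRel frac_equiv frac_equiv_refl frac_equiv_sym frac_equiv_trans.

Definition loc := {eq_quot frac_equiv}.
HB.instance Definition _ := EqQuotient.on loc.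
HB.instance Definition _ := Choice.on loc.

Definition mkloc (r s : R) (Ss : mult_set S s) : loc := \pi_loc (mkfrac r Ss).

Definition toloc (r : R) : loc := mkloc r (multset1 S).

Lemma mkloc_eqP r s r' s' (Ss : mult_set S s) (Ss' : mult_set S s') :
  mkloc r Ss = mkloc r' Ss' <-> exists2 u, mult_set S u & u * (r * s') = u * (r' * s).
Proof. by split=> [/eqquotP/asboolP|?]; last exact/eqquotP/asboolP. Qed.

Lemma locP (x : loc) : exists r s (Ss : mult_set S s), x = mkloc r Ss.
Proof.
elim/quotW: x => -[[r s] /= p]; exists r, s, (asboolW p).
by congr (\pi _); apply: val_inj.
Qed.

Definition loc_add (x y : loc) : loc :=
  let: (x', y') := (repr x, repr y) in
  mkloc (num x' * den y' + num y' * den x') (multsetM (denP x') (denP y')).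
Definition loc_opp (x : loc) : loc := mkloc (- num (repr x)) (denP (repr x)).
Definition loc_mul (x y : loc) : loc :=
  let: (x', y') := (repr x, repr y) in
  mkloc (num x' * num y') (multsetM (denP x') (denP y')).

Lemma repr_mkloc r s (Ss : mult_set S s) : exists2 u, mult_set S u &
  u * (num (repr (mkloc r Ss)) * s) = u * (r * den (repr (mkloc r Ss))).
Proof.
have /eqquotP/asboolP[u Su /= e] : \pi_loc (repr (mkloc r Ss)) = mkloc r Ss.
  by rewrite reprK.
by exists u.
Qed.

Lemma loc_addE r s r' s' (Ss : mult_set S s) (Ss' : mult_set S s') :
  loc_add (mkloc r Ss) (mkloc r' Ss') = mkloc (r * s' + r' * s) (multsetM Ss Ss').
Proof.
have [u Su e] := repr_mkloc r Ss; have [v Sv e'] := repr_mkloc r' Ss'.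
apply/mkloc_eqP; exists (u * v); first exact: multsetM.
set x := repr _ in e *; set y := repr _ in e' *.
have -> : u * v * ((num x * den y + num y * den x) * (s * s')) =
  v * den y * s' * (u * (num x * s)) + u * den x * s * (v * (num y * s')) by ring.
by rewrite e e'; ring.
Qed.

Lemma loc_oppE r s (Ss : mult_set S s) : loc_opp (mkloc r Ss) = mkloc (- r) Ss.
Proof.
have [u Su e] := repr_mkloc r Ss; apply/mkloc_eqP; exists u => //.
by rewrite !mulNr !mulrN e.
Qed.

Lemma loc_mulE r s r' s' (Ss : mult_set S s) (Ss' : mult_set S s') :
  loc_mul (mkloc r Ss) (mkloc r' Ss') = mkloc (r * r') (multsetM Ss Ss').
Proof.
have [u Su e] := repr_mkloc r Ss; have [v Sv e'] := repr_mkloc r' Ss'.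
apply/mkloc_eqP; exists (u * v); first exact: multsetM.
set x := repr _ in e *; set y := repr _ in e' *.
have -> : u * v * (num x * num y * (s * s')) =
  (u * (num x * s)) * (v * (num y * s')) by ring.
by rewrite e e'; ring.
Qed.

Let mkloc_eq r s r' s' (Ss : mult_set S s) (Ss' : mult_set S s') :
  r * s' = r' * s -> mkloc r Ss = mkloc r' Ss'.
Proof. by move=> e; apply/mkloc_eqP; exists 1; rewrite ?e //; apply: multset1. Qed.

Fact loc_addA : associative loc_add.
Proof.
move=> x y z; have [a [s [Ss ->]]] := locP x; have [b [t [St ->]]] := locP y.
have [c [u [Su ->]]] := locP z.
by rewrite !loc_addE; apply: mkloc_eq; ring.
Qed.
Fact loc_addC : commutative loc_add.
Proof.
move=> x y; have [a [s [Ss ->]]] := locP x; have [b [t [St ->]]] := locP y.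
by rewrite !loc_addE; apply: mkloc_eq; ring.
Qed.
Fact loc_add0 : left_id (toloc 0) loc_add.
Proof.
move=> x; have [a [s [Ss ->]]] := locP x.
by rewrite !loc_addE; apply: mkloc_eq; ring.
Qed.
Fact loc_addN : left_inverse (toloc 0) loc_opp loc_add.
Proof.
move=> x; have [a [s [Ss ->]]] := locP x.
by rewrite loc_oppE !loc_addE; apply: mkloc_eq; ring.
Qed.

HB.instance Definition _ :=
  GRing.isZmodule.Build loc loc_addA loc_addC loc_add0 loc_addN.

Fact loc_mulA : associative loc_mul.
Proof.
move=> x y z; have [a [s [Ss ->]]] := locP x; have [b [t [St ->]]] := locP y.
have [c [u [Su ->]]] := locP z.
by rewrite !loc_mulE; apply: mkloc_eq; ring.
Qed.
Fact loc_mulC : commutative loc_mul.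
Proof.
move=> x y; have [a [s [Ss ->]]] := locP x; have [b [t [St ->]]] := locP y.
by rewrite !loc_mulE; apply: mkloc_eq; ring.
Qed.
Fact loc_mul1 : left_id (toloc 1) loc_mul.
Proof.
move=> x; have [a [s [Ss ->]]] := locP x.
by rewrite !loc_mulE; apply: mkloc_eq; ring.
Qed.
Fact loc_mulDl : left_distributive loc_mul +%R.
Proof.
move=> x y z; have [a [s [Ss ->]]] := locP x; have [b [t [St ->]]] := locP y.
have [c [u [Su ->]]] := locP z.
rewrite -[X in loc_mul X _]/(loc_add _ _) -[RHS]/(loc_add _ _).
rewrite !(loc_addE, loc_mulE).
by apply: mkloc_eq; ring.
Qed.
Fact loc_nonzero1 : toloc 1 != toloc 0.
Proof.
apply/eqP => /mkloc_eqP[u Su]; rewrite !mulr1 mulr0 => u0.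
by apply: (@multset0 _ S); rewrite -u0.
Qed.

HB.instance Definition _ := GRing.Zmodule_isComNzRing.Build loc
  loc_mulA loc_mulC loc_mul1 loc_mulDl loc_nonzero1.

Fact toloc_zmod_morphism : zmod_morphism toloc.
Proof.
move=> x y; rewrite -[RHS]/(loc_add _ (loc_opp _)) loc_oppE loc_addE.
by apply: mkloc_eq; ring.
Qed.
Fact toloc_monoid_morphism : monoid_morphism toloc.
Proof.
split=> // x y; rewrite -[RHS]/(loc_mul _ _) loc_mulE.
by apply: mkloc_eq; ring.
Qed.
HB.instance Definition _ :=
  GRing.isZmodMorphism.Build R loc toloc toloc_zmod_morphism.
HB.instance Definition _ :=
  GRing.isMonoidMorphism.Build R loc toloc toloc_monoid_morphism.

End Localization.

Section PrimeComplement.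
Variables (R : comPzRingType) (P : spec R).

Fact prime_compl1 : (~` P) 1.
Proof. by case: (prime_setP P). Qed.
Fact prime_complM s t : (~` P) s -> (~` P) t -> (~` P) (s * t).
Proof. by case: (prime_setP P) => _ _ PM nPs nPt /PM[]. Qed.
Fact prime_compl0 : ~ (~` P) 0.
Proof. by case: (prime_setP P) => -[P0 _ _] _ _; apply. Qed.

Definition prime_compl : multset R :=
  MultSet prime_compl1 prime_complM prime_compl0.

End PrimeComplement.

Section NonZeroDivisors.
Variable R : comNzRingType.

Fact nonzerodiv1 : [set s : R | nonzerodiv s] 1.
Proof. by move=> x; rewrite mul1r. Qed.
Fact nonzerodivM s t : [set s : R | nonzerodiv s] s ->
  [set s : R | nonzerodiv s] t -> [set s : R | nonzerodiv s] (s * t).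
Proof. by move=> hs ht x; rewrite -mulrA => /hs/ht. Qed.
Fact nonzerodiv0 : ~ [set s : R | nonzerodiv s] 0.
Proof. by move=> /(_ 1 (mul0r 1))/eqP; rewrite oner_eq0. Qed.

Definition nonzerodivs : multset R :=
  MultSet nonzerodiv1 nonzerodivM nonzerodiv0.

End NonZeroDivisors.

(* totfrac R is the total ring of fractions, i.e. the fraction field when R is
   a domain. *)
Notation local_ring P := (loc (prime_compl P)).
Notation totfrac R := (loc (nonzerodivs R)).

Definition normal_domain (D : comNzRingType) : Prop :=
  (forall x y : D, x * y = 0 -> x = 0 \/ y = 0) /\
  (forall z : totfrac D,
     integralOver (@toloc D (nonzerodivs D)) z -> exists d, z = toloc _ d).

Definition normal_ring (R : comPzRingType) : Prop :=
  forall P : spec R, normal_domain (local_ring P).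

(* v is the normalized discrete valuation of Frac(R_P) whose valuation ring is
   R_P; it is unique on nonzero elements, and its value at 0 (mathematically
   infinite) is left unconstrained. *)
Definition valuation_at (R : comPzRingType) (P : spec R)
    (v : totfrac (local_ring P) -> int) : Prop :=
  [/\ forall x y, x != 0 -> y != 0 -> v (x * y) = v x + v y,
      forall x y, x != 0 -> y != 0 -> x + y != 0 ->
        Num.min (v x) (v y) <= v (x + y),
      exists2 x, x != 0 & v x = 1 &
      forall x, (exists r : local_ring P, x = toloc _ r) <->
        (x = 0 \/ 0 <= v x)].

Definition squarefree (R : comPzRingType) (h : R) : Prop :=
  forall P : spec R, height_eq P 1 ->
    exists2 v, @valuation_at R P v &
      let h' := toloc (nonzerodivs (local_ring P)) (toloc (prime_compl P) h) in
      h' != 0 /\ (v h' = 0 \/ v h' = 1).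

(* V(h, dh): the points P at which the image of h in R_P lies in m_P^2 *)
Definition Vsing (R : comPzRingType) (h : R) : set (spec R) :=
  [set P | let m := @nonunits (local_ring P) in
    ideal_set (ideal_mul m m) (toloc _ h)].

(* Discriminant of a monic p, (-1)^(d(d-1)/2) * prod_i p'(x_i) over the d roots
   x_i of p. MathComp's Sylvester matrix lists coefficients in increasing
   degree, so its [resultant q p] is prod_i q(x_i) for monic p whatever the
   degree of q; [resultant p q] differs by the sign (-1)^(deg p * deg q), where
   deg p' depends on the characteristic. *)
Definition disc_monic (R : comNzRingType) (p : {poly R}) : R :=
  (-1) ^+ 'C((size p).-1, 2) * resultant p^`() p.

Section SignedSplitting.
Variables (A : comNzRingType) (n : nat).

Definition ssplit_ideal (f : {poly A}) : ideal {mpoly A[n]} :=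
  idealgen (range (fun k : nat =>
    (map_poly (@mpolyC n A) f - \prod_(i < n) ('X^2 - ('X_i ^+ 2)%:P))`_k)).

Definition SSplit (f : {poly A}) : comPzRingType := quotring (ssplit_ideal f).

(* Only the values a 0, a 2, ..., a (2 * n) are used. *)
Variable a : nat -> A.

Definition fpoly : {poly A} :=
  \sum_(i < n.+1) a (2 * n - 2 * i)%N *: 'X^(2 * i).

Definition ftilde : {poly A} := \sum_(i < n.+1) a (2 * n - 2 * i)%N *: 'X^i.

Definition Delta : A :=
  (-1) ^+ n * 4 ^+ n * a (2 * n)%N * disc_monic ftilde.

End SignedSplitting.

(* Main.v *)
(* The squarefreeness of Delta is read off at a height one prime P: A_P is a
   discrete valuation ring, and Delta is not in the square of its maximal ideal.

   For B, let G be the group of signed permutations of the eta_i and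
   J = det(2 eta_i^(2r+1)), so that J^2 = Delta. The formula
   T(y) = (sum_g sgn(g) g(y)) / J defines an A-linear form T : B -> A for which
   B is a Frobenius algebra: x = sum_k T(x b'_k) b_k for dual families b, b'.
   Fix a prime P of A. Let z be integral over B_P, in the localization of B at
   the nonzero elements of A_P, and put t = T(z b) with b in B. Then J t is a
   signed sum of conjugates of z b, so it is integral, and so is its square
   Delta t^2. Hence (Delta t)^2 is divisible by Delta in the normal domain A_P,
   where Delta generates a radical ideal by (c): an associated prime of Delta is
   locally principal, hence of height at most one. So t lies in A_P for every b,
   and z lies in B_P by duality. The same argument shows that B_P is reduced;
   idempotents being integral, its local rings are normal domains.

   Integrality is handled through bounded denominators: x / d is integral as
   soon as c x^k is divisible by d^k for all k, for a fixed nonzero c. *)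

Require Import Defs.
From HB Require Import structures.
From mathcomp Require Import all_boot all_order all_algebra generic_quotient.
From mathcomp Require Import perm ssrcomplements mpoly ring zify.
From mathcomp Require Import boolp classical_sets.

Set Implicit Arguments.
Unset Strict Implicit.
Unset Printing Implicit Defensive.

Import Order.TTheory GRing.Theory Num.Theory.
Local Open Scope classical_set_scope.
Local Open Scope quotient_scope.
Local Open Scope ring_scope.

Lemma dependent_choice_seq (T : Type) (R : T -> T -> Prop) (x0 : T) :
  (forall x, exists y, R x y) ->
  exists f : nat -> T, f 0%N = x0 /\ forall k, R (f k) (f k.+1).
Proof.
move=> /choice[g Rg]; exists (fun k => iter k g x0).
by split=> // k; apply: Rg.
Qed.

(** * Noetherian rings and their localizations *)

Section Noetherian.
Variables (R : comPzRingType) (hR : noetherian R).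

Lemma ideal_sum (I : set R) (J : finType) (r a : J -> R) :
  is_ideal I -> (forall i, I (a i)) -> I (\sum_i r i * a i).
Proof.
move=> [I0 ID IM] Ia; elim/big_ind: _ => // i _; exact: IM.
Qed.

(** The union of the spans of the initial segments of [a] is an ideal. Its finitely many generators
    already lie in one span, which therefore contains every term of the sequence. *)
Lemma noetherian_seq (a : nat -> R) :
  exists m (r : nat -> R), a m = \sum_(i < m) r i * a i.
Proof.
pose span m := [set x | exists r : nat -> R, x = \sum_(i < m) r i * a i].
have spanI m : is_ideal (span m).
  split=> [|_ _ [r ->] [s ->]|b _ [r ->]].
  - by exists (fun=> 0); rewrite big1 // => i _; rewrite mul0r.
  - exists (fun i => r i + s i); rewrite -big_split.
    by apply: eq_bigr => i _; rewrite mulrDl.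
  - exists (fun i => b * r i); rewrite mulr_sumr.
    by apply: eq_bigr => i _; rewrite mulrA.
have span_le m k : (m <= k)%N -> (span m `<=` span k).
  move=> mk _ [r ->]; exists (fun i => if (i < m)%N then r i else 0).
  rewrite (big_ord_widen _ (fun i => r i * a i) mk) big_mkcond.
  by apply: eq_bigr => i _; case: ifP; rewrite ?mul0r.
have span_in m k : (m < k)%N -> span k (a m).
  move=> mk; exists (fun i => (i == m)%:R).
  rewrite (bigD1 (Ordinal mk)) //= eqxx mul1r big1 ?addr0 // => i ik.
  by rewrite -val_eqE /= in ik; rewrite (negPf ik) mul0r.
have allI : is_ideal [set x | exists m, span m x].
  split=> [|x y [m sx] [k sy]|b x [m sx]].
  - by exists 0%N; case: (spanI 0%N).
  - exists (maxn m k); have [_ sD _] := spanI (maxn m k).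
    by apply: sD; [apply: span_le sx; apply: leq_maxl
                  |apply: span_le sy; apply: leq_maxr].
  - by exists m; case: (spanI m) => _ _; apply.
have [k [g Eg]] := hR (Ideal allI).
have /choice[N sN] : forall j, exists m, span m (g j).
  move=> j; suff : ideal_set (Ideal allI) (g j) by [].
  rewrite -Eg; exists 1%N, (fun=> 1), (fun=> g j).
  by split=> [_|]; [exists j|rewrite big_ord1 mul1r].
pose m := \max_j N j.
suff [r Er] : span m (a m) by exists m, r.
have : ideal_set (Ideal allI) (a m) by exists m.+1; apply: span_in.
rewrite -Eg => -[l [c [h [hg ->]]]].
apply: ideal_sum => // i; have [j _ <-] := hg i.
by apply: span_le (sN j); apply: leq_bigmax.
Qed.

(** Without a maximal member, dependent choice builds a strictly increasing chain; elements
    witnessing the strictness would form a sequence contradicting [noetherian_seq]. *)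
Lemma noetherian_max (F : set (set R)) (I0 : set R) : F I0 ->
  (forall I, F I -> is_ideal I) ->
  exists2 I, F I & forall J, F J -> (I `<=` J) -> (J `<=` I).
Proof.
move=> F0 Fid; apply: contrapT => nomax.
have next (I : {I | F I}) : exists J : {I | F I},
    (proj1_sig I `<=` proj1_sig J) /\
    exists x, proj1_sig J x /\ ~ proj1_sig I x.
  case: I => I FI /=; apply: contrapT => noJ; apply: nomax; exists I => // J FJ IJ x Jx.
  by apply: contrapT => nIx; apply: noJ; exists (exist _ J FJ); split=> //; exists x.
have [f [_ fS]] := dependent_choice_seq (exist _ I0 F0) next.
have f_le m k : (m <= k)%N -> (proj1_sig (f m) `<=` proj1_sig (f k)).
  move=> /subnK <-; elim: (k - m)%N => // l IH x /IH; rewrite addSn.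
  exact: (proj1 (fS _)).
have /choice[a aP] : forall k, exists x, proj1_sig (f k.+1) x /\ ~ proj1_sig (f k) x.
  by move=> k; case: (fS k).
have [m [r Er]] := noetherian_seq a.
case: (aP m) => _; apply; rewrite Er; apply: ideal_sum => [|i].
  exact: Fid (proj2_sig _).
by apply: f_le (proj1 (aP i)).
Qed.

End Noetherian.

Section LocalDivisibility.
Variables (R : comPzRingType) (P : spec R).

(* [lzero a]: [a] vanishes in [R_P]; [ldvd d x]: [d] divides [x] in [R_P]. *)
Definition lzero (a : R) := exists2 s, ~ prime_set P s & s * a = 0.
Definition ldvd (d x : R) := exists s c, ~ prime_set P s /\ s * x = d * c.

Lemma primeM s t : ~ prime_set P s -> ~ prime_set P t -> ~ prime_set P (s * t).
Proof. exact: (@prime_complM _ P). Qed.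
Lemma prime1 : ~ prime_set P 1. Proof. exact: (@prime_compl1 _ P). Qed.
Lemma prime0 : prime_set P 0. Proof. by case: (prime_setP P) => -[]. Qed.
Lemma primeD x y : prime_set P x -> prime_set P y -> prime_set P (x + y).
Proof. by case: (prime_setP P) => -[_ + _] _ _; apply. Qed.
Lemma primeMl a x : prime_set P x -> prime_set P (a * x).
Proof. by case: (prime_setP P) => -[_ _ +] _ _; apply. Qed.
Lemma primeN x : prime_set P x -> prime_set P (- x).
Proof. by rewrite -mulN1r; apply: primeMl. Qed.
Lemma prime_or x y : prime_set P (x * y) -> prime_set P x \/ prime_set P y.
Proof. by case: (prime_setP P) => _ _; apply. Qed.
Lemma prime_prod (I : finType) (s : I -> R) :
  (forall i, ~ prime_set P (s i)) -> ~ prime_set P (\prod_i s i).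
Proof.
by move=> ns; elim/big_ind: _ => //; [apply: prime1|apply: primeM].
Qed.

Lemma toloc_eq0 a : toloc (prime_compl P) a = 0 <-> lzero a.
Proof.
rewrite -[0]/(toloc _ 0); split.
  by move=> /mkloc_eqP[u nu]; rewrite mulr1 mul0r mulr0; exists u.
by move=> [u nu u0]; apply/mkloc_eqP; exists u => //; rewrite mulr1 mul0r mulr0.
Qed.

Lemma toloc_unit s (ns : ~ prime_set P s) : exists y, toloc (prime_compl P) s * y = 1.
Proof.
exists (@mkloc _ (prime_compl P) 1 s ns); rewrite -[_ * _]/(loc_mul _ _) loc_mulE.
by apply/mkloc_eqP; exists 1; [exact: prime1|rewrite !mulr1 !mul1r].
Qed.

Lemma lzero_eq a b : lzero (a - b) -> exists2 s, ~ prime_set P s & s * a = s * b.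
Proof. by move=> [s ns]; rewrite mulrBr => /subr0_eq; exists s. Qed.

Lemma lzero_or : normal_domain (local_ring P) ->
  forall x y, lzero (x * y) -> lzero x \/ lzero y.
Proof.
move=> [dom _] x y /toloc_eq0; rewrite rmorphM /= => /dom.
by rewrite !toloc_eq0.
Qed.

Lemma lzero_notin s : ~ prime_set P s -> ~ lzero s.
Proof. by move=> ns [t nt ts]; apply: (primeM nt ns); rewrite ts; apply: prime0. Qed.

End LocalDivisibility.

Section TotalFractions.
Variable D : comNzRingType.

Lemma tofrac_inj (x y : D) :
  toloc (nonzerodivs D) x = toloc (nonzerodivs D) y -> x = y.
Proof.
move=> /mkloc_eqP[u nzu]; rewrite !mulr1 => e.
by apply: subr0_eq; apply: nzu; rewrite mulrBr e subrr.
Qed.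

Lemma tofrac_unit (d : D) : nonzerodiv d ->
  exists y, toloc (nonzerodivs D) d * y = 1.
Proof.
move=> nzd; exists (@mkloc _ (nonzerodivs D) 1 d nzd).
rewrite -[_ * _]/(loc_mul _ _) loc_mulE.
by apply/mkloc_eqP; exists 1; [exact: nonzerodiv1|rewrite !mulr1 !mul1r].
Qed.

End TotalFractions.

Section LocalIntegrality.
Variables (R : comPzRingType) (P : spec R).
Hypothesis nP : normal_domain (local_ring P).

Lemma toloc_nzd d : ~ lzero P d -> nonzerodiv (toloc (prime_compl P) d).
Proof.
by move=> nzd x /(proj1 nP)[/toloc_eq0|//] /nzd.
Qed.

(** Division by [s * d ^+ m] turns the relation into a monic equation for [t / d] over [R_P], and
    normality applies. *)
Lemma ldvd_integral d t s m (r : nat -> R) : ~ lzero P d -> ~ prime_set P s ->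
  s * t ^+ m = \sum_(i < m) r i * (t ^+ i * d ^+ (m - i)) -> ldvd P d t.
Proof.
move=> nzd ns e.
pose i0 : {rmorphism R -> local_ring P} := toloc (prime_compl P).
pose j : {rmorphism local_ring P -> totfrac (local_ring P)} :=
  toloc (nonzerodivs (local_ring P)).
have [y jdy] := tofrac_unit (toloc_nzd nzd).
have [c sc] := toloc_unit ns.
have : integralOver j (y * j (i0 t)).
  exists ('X^m - \poly_(i < m) (c * i0 (r i))).
    rewrite monicE lead_coefDl ?lead_coefXn // size_polyN size_polyXn ltnS.
    exact: size_poly.
  have -> : map_poly j ('X^m - \poly_(i < m) (c * i0 (r i))) =
            'X^m - \poly_(i < m) (j (c * i0 (r i))).
    rewrite rmorphB /= map_polyXn; congr (_ - _); apply/polyP => k.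
    by rewrite coef_map !coef_poly; case: ifP => //= _; rewrite rmorph0.
  rewrite rootE hornerD hornerN hornerXn horner_poly.
  have -> : (y * j (i0 t)) ^+ m = y ^+ m * j (i0 (t ^+ m)).
    by rewrite exprMn !rmorphXn.
  have -> : i0 (t ^+ m) = c * i0 (s * t ^+ m).
    by rewrite rmorphM mulrA [c * _]mulrC sc mul1r.
  rewrite e rmorph_sum !mulr_sumr rmorph_sum mulr_sumr -sumrB big1 // => i _.
  have -> : y ^+ m = y ^+ i * y ^+ (m - i) by rewrite -exprD subnKC // ltnW.
  rewrite exprMn !rmorphM /= !rmorphXn /=.
  have -> : y ^+ i * y ^+ (m - i) * (j c * (j (i0 (r i)) *
              (j (i0 t) ^+ i * j (i0 d) ^+ (m - i)))) =
            j c * j (i0 (r i)) * (y ^+ i * j (i0 t) ^+ i) *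
            (j (i0 d) * y) ^+ (m - i) by rewrite [in RHS]exprMn; ring.
  by rewrite jdy expr1n mulr1 subrr.
move=> /(proj2 nP)[x ex].
have [a [u [nu xau]]] := locP x.
have ux : i0 u * x = i0 a.
  rewrite xau -[_ * _]/(loc_mul _ _) loc_mulE.
  by apply/mkloc_eqP; exists 1; [exact: prime1|ring].
have dx : i0 d * x = i0 t.
  apply: tofrac_inj; rewrite rmorphM /= -/j -ex mulrA jdy mul1r //.
have : i0 (u * t - d * a) = 0.
  by rewrite rmorphB !rmorphM -/i0 -ux -dx /=; ring.
move=> /toloc_eq0/lzero_eq[v nv ev].
exists (v * u), (v * a); split; first exact: primeM.
by rewrite -mulrA ev; ring.
Qed.

Hypothesis hR : noetherian R.

Lemma lzero_dom x y : ~ lzero P x -> lzero P (x * y) -> lzero P y.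
Proof. by move=> nx /(lzero_or nP)[]. Qed.

Lemma lzeroM x y : ~ lzero P x -> ~ lzero P y -> ~ lzero P (x * y).
Proof. by move=> nx ny /(lzero_or nP)[]. Qed.

Lemma lzeroX x k : ~ lzero P x -> ~ lzero P (x ^+ k).
Proof.
move=> nx; elim: k => [|k IH]; first exact: (lzero_notin (@prime1 _ P)).
by rewrite exprS; apply: lzeroM.
Qed.

(* The denominators of the powers of t/d are bounded, so t/d is integral. *)
Lemma ldvd_completely_integral d c t : ~ lzero P d -> ~ lzero P c ->
  (forall k, ldvd P (d ^+ k) (c * t ^+ k)) -> ldvd P d t.
Proof.
move=> nd nc /choice[s] /choice[a sa].
(* Up to units, [a k] is [c * (t / d) ^+ k]. A linear relation expressing one of these by the
   earlier ones becomes, after cancelling [c], an integral equation for [t / d]. *)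
have [m [r e]] := noetherian_seq hR a.
pose S := \prod_(i < m) s i.
have nS : ~ prime_set P S by apply: prime_prod => i; case: (sa i).
pose S' (i : nat) := \prod_(j < m | j != i :> nat) s j.
have ES (i : 'I_m) : S = s i * S' i by rewrite /S (bigD1 i).
have [nsm em] := sa m.
have /(lzero_dom nc)/lzero_eq[u nu eu] : lzero P (c * (S * s m * t ^+ m -
  \sum_(i < m) r i * S' i * s i * s i * (t ^+ i * d ^+ (m - i)))).
  exists 1; first exact: prime1.
  rewrite mul1r mulrBr.
  have -> : c * (S * s m * t ^+ m) = S * (s m * (c * t ^+ m)) by ring.
  rewrite em e !mulr_sumr -sumrB big1 // => i _.
  have [_ ei] := sa i.
  have -> : d ^+ m = d ^+ i * d ^+ (m - i) by rewrite -exprD subnKC // ltnW.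
  apply/eqP; rewrite subr_eq0; apply/eqP; rewrite {1}(ES i).
  transitivity (r i * S' i * s i * d ^+ (m - i) * (d ^+ i * a i)); first by ring.
  by rewrite -ei; ring.
apply: (@ldvd_integral d t (u * (S * s m)) m (fun i => u * (r i * S' i * s i * s i))) => //.
  by do 3?apply: primeM.
rewrite -mulrA eu mulr_sumr; apply: eq_bigr => i _; ring.
Qed.

End LocalIntegrality.

(** * Primes of height one *)

Section PrincipalPrimes.
Variables (R : comPzRingType) (hR : noetherian R).

Definition locally_principal (P : spec R) (q : R) :=
  forall a, prime_set P a -> exists v c, ~ prime_set P v /\ v * a = c * q.

(* Associated primes of [d]: a maximal ideal among the [(d : r t)] in [R_P] is
   prime, and normality makes it locally principal. *)
Lemma associated_prime (P : spec R) d t : normal_domain (local_ring P) ->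
  ~ lzero P d -> ~ ldvd P d t ->
  exists (Q : spec R) x q s u,
    [/\ prime_set Q `<=` prime_set P, exists r, x = r * t,
        forall a, prime_set Q a <-> ldvd P d (a * x),
        [/\ prime_set Q q, ~ prime_set P s, ~ prime_set Q u & s * q * x = d * u]
      & locally_principal Q q].
Proof.
move=> nP nd ndt.
pose colon x : set R := [set a | ldvd P d (a * x)].
have colonI x : is_ideal (colon x).
  split=> [|a b [s [c [ns e]]] [s' [c' [ns' e']]]|a b [s [c [ns e]]]].
  - by exists 1, 0; split; [exact: prime1|rewrite mul0r !mulr0].
  - exists (s * s'), (s' * c + s * c'); split; first exact: primeM.
    transitivity (s' * (s * (a * x)) + s * (s' * (b * x))); first by ring.
    by rewrite e e'; ring.
  - exists s, (a * c); split=> //.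
    by transitivity (a * (s * (b * x))); [ring|rewrite e; ring].
(* The proper annihilators of multiples of [t] in [R_P / d]; a maximal one is prime. *)
pose F := [set I | exists x, [/\ I = colon x, exists r, x = r * t & ~ ldvd P d x]].
have F1 : F (colon t) by exists t; split=> //; exists 1; rewrite mul1r.
have FI I : F I -> is_ideal I by case=> x [-> _ _].
have [_ [x [-> [r xrt] ndx]] colonmax] := noetherian_max hR F1 FI.
have colonP a : colon x a -> prime_set P a.
  move=> [s [c [ns e]]]; apply: contrapT => nPa; apply: ndx.
  by exists (s * a), c; split; [exact: primeM|rewrite -e; ring].
have Qp : is_prime (colon x).
  split=> [//||a b abx]; first by move=> /colonP; apply: prime1.
  have [?|nbx] := EM (colon x b); [by right|left].
  (* Maximality is applied to [colon (b * x)], which contains [colon x] and also [a]. *)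
  have Fb : F (colon (b * x)).
    by exists (b * x); split=> //; exists (b * r); rewrite xrt mulrA.
  apply: (colonmax _ Fb) => [c [s [e [ns ec]]]|].
    exists s, (b * e); split=> //.
    by transitivity (b * (s * (c * x))); [ring|rewrite ec; ring].
  by rewrite /colon /= mulrA.
pose Q := Spec Qp.
(* Otherwise multiplication by [x / d] maps [Q] into itself locally at [P]. Iterating it from [d]
   shows that [d * (x / d) ^+ k] always lies in [R_P], so [x / d] does too, by complete
   integrality. *)
have [q [s [u [Qq ns nu e]]]] : exists q s u, [/\ colon x q, ~ prime_set P s,
    ~ colon x u & s * q * x = d * u].
  apply: contrapT => none.
  have next (a : {a | colon x a}) : exists b : {b | colon x b},
      exists2 s, ~ prime_set P s & s * (proj1_sig a * x) = d * proj1_sig b.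
    case: a => a Qa /=; have [s [c [ns e]]] := Qa.
    have Qc : colon x c.
      by apply: contrapT => nQc; apply: none; exists a, s, c; split; rewrite -?mulrA.
    by exists (exist _ c Qc), s.
  have Qd : colon x d by exists 1, x; split; [exact: prime1|rewrite mul1r].
  have [f [f0 fS]] := dependent_choice_seq (exist _ d Qd) next.
  apply: ndx; apply: (ldvd_completely_integral nP hR nd nd) => k.
  suff [s ns e] : exists2 s, ~ prime_set P s &
      s * (d * x ^+ k) = d ^+ k * proj1_sig (f k).
    by exists s, (proj1_sig (f k)).
  elim: k => [|k [s ns e]].
    by exists 1; [exact: prime1|rewrite f0 !expr0 /=; ring].
  have [s' ns' e'] := fS k.
  exists (s' * s); first exact: primeM.
  transitivity (s' * (s * (d * x ^+ k)) * x); first by rewrite exprS; ring.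
  rewrite e; transitivity (d ^+ k * (s' * (proj1_sig (f k) * x))); first by ring.
  by rewrite e' exprS; ring.
exists Q, x, q, s, u; split=> //; first by exists r.
move=> a [s' [c [ns' ec]]].
(* Comparing [a * x] with [q * x], both multiples of [d], and cancelling [d] exhibits [a] as a
   multiple of [q], because [u] is invertible at [Q]. *)
have /(lzero_dom nP nd)/lzero_eq[v nv ev] : lzero P (d * (s' * u * a - s * c * q)).
  exists 1; first exact: prime1.
  transitivity (s' * a * (d * u) - (d * c) * (s * q)); first by ring.
  by rewrite -e -ec; ring.
exists (v * (s' * u)), (v * s * c); split.
  have nQ y : ~ prime_set P y -> ~ prime_set Q y by move=> ny Qy; apply: ny (colonP _ Qy).
  by apply: (@primeM _ Q); [exact: nQ|apply: (@primeM _ Q) => //; exact: nQ].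
by rewrite -mulrA ev; ring.
Qed.

(** A form of Krull's intersection theorem. Repeated division of [a] by [q] gives a sequence of
    quotients inside [C]; a linear relation among them, combined with [q] being in [P], forces [a]
    to vanish in [R_P]. *)
Lemma krull_intersection (P : spec R) (q : R) (C : R -> Prop) : prime_set P q ->
  (forall a, C a -> exists v c, [/\ ~ prime_set P v, C c & v * a = c * q]) ->
  forall a, C a -> lzero P a.
Proof.
move=> Pq divq a Ca.
have next (b : {b | C b}) : exists c : {c | C c},
    exists2 v, ~ prime_set P v & v * proj1_sig b = proj1_sig c * q.
  by case: b => b Cb; have [v [c [nv Cc e]]] := divq b Cb; exists (exist _ c Cc), v.
have [f [f0 fS]] := dependent_choice_seq (exist _ a Ca) next.
have /choice[v vP] : forall k, exists v, ~ prime_set P v /\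
    v * proj1_sig (f k) = proj1_sig (f k.+1) * q.
  by move=> k; have [w] := fS k; exists w.
have nV i m : ~ prime_set P (\prod_(i <= k < m) v k).
  elim/big_ind: _ => //; [exact: prime1|exact: primeM|].
  by move=> k _; case: (vP k).
have Vf i m : (i <= m)%N -> \prod_(i <= k < m) v k * proj1_sig (f i) =
    q ^+ (m - i) * proj1_sig (f m).
  elim: m => [|m IH].
    by rewrite leqn0 => /eqP->; rewrite big_geq.
  rewrite leq_eqVlt => /predU1P[->|]; first by rewrite big_geq // subnn.
  rewrite ltnS => im; rewrite big_nat_recr //= subSn // exprSr.
  rewrite mulrAC IH // -!mulrA [sval _ * v m]mulrC (proj2 (vP m)); ring.
have [m [r em]] := noetherian_seq hR (fun k => proj1_sig (f k)).
pose V := \prod_(0 <= k < m) v k.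
(* The relation among the quotients says that [W] annihilates [V * a = q ^+ m * f m]. Modulo [q],
   [W] is [V], so it lies outside [P]. *)
pose W := V - \sum_(i < m) r i * \prod_(0 <= k < i) v k * q ^+ (m - i).
exists (W * V).
  apply: primeM; last exact: nV.
  move=> PW; apply: (nV 0%N m).
  rewrite -/V -[V](subrK (\sum_(i < m) r i * \prod_(0 <= k < i) v k * q ^+ (m - i))).
  apply: primeD => //; elim/big_ind: _ => [||i _].
  - exact: prime0.
  - exact: primeD.
  - by rewrite -[(m - i)%N]prednK ?subn_gt0 // exprSr mulrA; apply: primeMl.
have := Vf 0%N m isT; rewrite f0 /= subn0 -/V -mulrA => ->.
rewrite mulrCA mulrBl {1}em mulr_sumr mulr_suml -sumrB big1 ?mulr0 // => i _.
rewrite -!mulrA -Vf; last exact: ltnW.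
by rewrite /V (big_cat_nat (leq0n i) (ltnW (ltn_ord i))) /=; ring.
Qed.

(** In a chain of primes [C 0], [C 1], [P] the element [q] is outside [C 1], so dividing an element
    of [C 1] by [q] stays in [C 1]. By Krull's intersection [C 1] vanishes in [R_P], hence lies in
    [C 0]. *)
Lemma locally_principal_height (P : spec R) q :
  prime_set P q -> locally_principal P q -> ~ height_ge P 2.
Proof.
move=> Pq prin [C [C2 Clt]].
have := Clt 0%N isT; have := Clt 1%N isT; rewrite C2.
move=> [le12 /existsNP[b /not_implyP[Pb nb]]] [le01 nle10].
have Cq : ~ prime_set (C 1%N) q.
  move=> Cq; have [v [c [nv e]]] := prin b Pb.
  have /prime_or[Cv|//] : prime_set (C 1%N) (v * b) by rewrite e; apply: primeMl.
  by apply: nv; apply: le12.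
apply: nle10 => a Ca.
have [|v nv va0] := krull_intersection Pq (C := prime_set (C 1%N)) _ Ca.
  move=> c Cc; have [v [e [nv ce]]] := prin c (le12 _ Cc).
  exists v, e; split=> //.
  by have /prime_or[] : prime_set (C 1%N) (e * q) by rewrite -ce; apply: primeMl.
have /prime_or[Cv|//] : prime_set (C 0%N) (v * a) by rewrite va0; apply: prime0.
by case: nv; apply: le12; apply: le01.
Qed.

(** An element [d] of [P] outside a smaller prime is nonzero in [R_P] and does not divide 1 there.
    The associated prime it yields is locally principal, contains [d], and must be [P] itself
    because the height is one. *)
Lemma height1_locally_principal (P : spec R) : normal_domain (local_ring P) ->
  height_eq P 1 -> exists2 q, prime_set P q & locally_principal P q.
Proof.
move=> nP [[C [C1 Clt]] nh2].
have [le01 /existsNP[d /not_implyP[]]] := Clt 0%N isT; rewrite C1 => Pd nd.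
have nzd : ~ lzero P d.
  move=> [s ns sd0].
  have /prime_or[Cs|//] : prime_set (C 0%N) (s * d) by rewrite sd0; apply: prime0.
  by apply: ns; rewrite -C1; apply: le01.
have nd1 : ~ ldvd P d 1.
  move=> [s [c [ns]]]; rewrite mulr1 => sdc; apply: ns.
  by rewrite sdc mulrC; apply: primeMl.
have [Q [x [q [s [u [QP _ QE [Qq ns nu e]] prinQ]]]]] := associated_prime nP nzd nd1.
suff PQ : prime_set P `<=` prime_set Q.
  exists q; first exact: QP.
  move=> a /PQ/prinQ[v [c [nv ec]]]; exists v, c; split=> //.
  by move=> /PQ.
apply: contrapT => nPQ; apply: nh2.
(* The kernel of the map to [R_P] is the bottom of the chain that would end with [Q] strictly inside
   [P]. *)
have Np : is_prime [set a | lzero P a].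
  split; first split.
  - by exists 1; [exact: prime1|rewrite mulr0].
  - move=> a b [s1 n1 e1] [s2 n2 e2]; exists (s1 * s2); first exact: primeM.
    transitivity (s2 * (s1 * a) + s1 * (s2 * b)); first by ring.
    by rewrite e1 e2; ring.
  - by move=> a b [s1 n1 e1]; exists s1 => //; rewrite mulrCA e1 mulr0.
  - by move=> /=; apply: lzero_notin; apply: prime1.
  - exact: lzero_or.
exists (fun k => if k is k.+1 then if k is 0 then Q else P else Spec Np).
split=> //; case=> [_|[_|//]] /=; split=> //.
- move=> a [s1 n1 e1]; apply/QE; exists s1, 0; split=> //.
  by rewrite mulrA e1; ring.
- move=> /(_ d); apply: contra_not nzd; apply; apply/QE.
  by exists 1, x; split; [exact: prime1|rewrite mul1r].
Qed.

End PrincipalPrimes.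

(** * The discrete valuation attached to a uniformizer *)

Section UniformizerValuation.
Variables (D : comNzRingType) (p : D).
Hypothesis domD : forall x y : D, x * y = 0 -> x = 0 \/ y = 0.
Hypothesis p_neq0 : p != 0.

Let unit (x : D) := exists y, x * y = 1.
Hypothesis p_nonunit : ~ unit p.
Hypothesis p_factor : forall x, x != 0 -> exists w k, unit w /\ x = w * p ^+ k.

Let j : {rmorphism D -> totfrac D} := toloc (nonzerodivs D).

Let unitM x y : unit x -> unit y -> unit (x * y).
Proof.
by move=> [z ex] [t ey]; exists (z * t); rewrite mulrACA ex ey mulr1.
Qed.

Let unitV x x' : x * x' = 1 -> unit x'.
Proof. by move=> e; exists x; rewrite mulrC. Qed.

Let nzd (x : D) : x != 0 -> nonzerodiv x.
Proof. by move=> x0 y /domD[] // e; rewrite e eqxx in x0. Qed.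

Let pX_nzd k : nonzerodiv (p ^+ k).
Proof.
elim: k => [|k IH]; first by rewrite expr0; apply: nonzerodiv1.
by rewrite exprS; apply: (nonzerodivM (nzd p_neq0) IH).
Qed.

Let j_cancel k x y : x * j (p ^+ k) = y * j (p ^+ k) -> x = y.
Proof.
have [z ez] := tofrac_unit (@pX_nzd k).
by move=> /(congr1 ( *%R^~ z)); rewrite -!mulrA ez !mulr1.
Qed.

Let unit_pX_inj w w' k l : unit w -> unit w' -> w * p ^+ k = w' * p ^+ l -> k = l.
Proof.
wlog lkl : w w' k l / (k <= l)%N => [H uw uw' e|[y wy] uw'].
  case: (leqP k l) => [|/ltnW] lkl; first exact: H e.
  by apply: esym; apply: H (esym e).
rewrite -[in p ^+ l](subnK lkl) exprD mulrA => /eqP.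
rewrite -subr_eq0 -mulrBl mulrC => /eqP/pX_nzd/subr0_eq e.
case: (posnP (l - k)) => [/eqP|pos]; first by rewrite subn_eq0 => ?; apply/anti_leq/andP.
case: p_nonunit; exists (w' * p ^+ (l - k).-1 * y).
by rewrite -wy e -[in RHS](prednK pos) exprS; ring.
Qed.

Let has_val (z : totfrac D) (k : int) := exists w i l,
  [/\ unit w, z * j (p ^+ l) = j (w * p ^+ i) & k = i%:Z - l%:Z].

Let has_val_fun z k k' : has_val z k -> has_val z k' -> k = k'.
Proof.
move=> [w [i [l [uw e ->]]]] [w' [i' [l' [uw' e' ->]]]].
have : w * p ^+ (i + l') = w' * p ^+ (i' + l).
  apply: tofrac_inj; rewrite !exprD !mulrA !(rmorphM j (_ * _)) /= -e -e'; ring.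
by move=> /(unit_pX_inj uw uw') eil; lia.
Qed.

Let has_val_ex (z : totfrac D) : z != 0 -> exists k, has_val z k.
Proof.
have [a [b [nzb ->]]] := locP z => nz.
have jE : @mkloc _ (nonzerodivs D) a b nzb * j b = j a.
  rewrite -[LHS]/(loc_mul _ _) loc_mulE.
  by apply/mkloc_eqP; exists 1; [exact: nonzerodiv1|ring].
have a0 : a != 0.
  apply: contraNneq nz => a0; have [y ey] := tofrac_unit nzb.
  by rewrite -[mkloc _ _]mulr1 -ey mulrA jE a0 rmorph0 mul0r.
have b0 : b != 0.
  apply: contraTneq (oner_neq0 D) => b0.
  by apply/negPn/eqP/(nzb : nonzerodiv b); rewrite b0 mul0r.
have [w [i [uw ea]]] := p_factor a0; have [w' [l [[y wy] eb]]] := p_factor b0.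
exists (i%:Z - l%:Z), (w * y), i, l; split=> //.
  exact: unitM (unitV wy).
have -> : p ^+ l = b * y by rewrite eb mulrAC wy mul1r.
rewrite (rmorphM j b y) mulrA jE -(rmorphM j) /= ea; congr (j _); ring.
Qed.

(** Every nonzero fraction is a unit times [p ^+ i] over [p ^+ l], and [i - l] is well defined
    because [p] is not a unit. *)
Lemma uniformizer_valuation : exists v : totfrac D -> int,
  [/\ forall x y, x != 0 -> y != 0 -> v (x * y) = v x + v y,
      forall x y, x != 0 -> y != 0 -> x + y != 0 ->
        Num.min (v x) (v y) <= v (x + y),
      forall w k, unit w -> v (j (w * p ^+ k)) = k%:Z &
      forall x, (exists r : D, x = j r) <-> (x = 0 \/ 0 <= v x)].
Proof.
(* The default 0 concerns only [z = 0]. *)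
pose v z := xget 0 [set k | has_val z k].
have vP z : z != 0 -> has_val z (v z).
  by move=> /has_val_ex[k vk]; apply: (xgetPex 0); exists k.
have vE z k : has_val z k -> v z = k.
  move=> zk; have vz : has_val z (v z) by apply: (xgetPex 0); exists k.
  exact: has_val_fun vz zk.
have vj w k : unit w -> v (j (w * p ^+ k)) = k%:Z.
  move=> uw; apply: vE; exists w, k, 0%N; split; rewrite ?subr0 //.
  by rewrite expr0 rmorph1 mulr1.
exists v; split.
- move=> x y /vP[w [i [l [uw e ->]]]] /vP[w' [i' [l' [uw' e' ->]]]].
  apply: vE; exists (w * w'), (i + i')%N, (l + l')%N; split; last by lia.
    exact: unitM.
  rewrite exprD (rmorphM j) mulrACA e e' -(rmorphM j) exprD /=; congr (j _); ring.
- have add x y : x != 0 -> y != 0 -> x + y != 0 -> v x <= v y -> v x <= v (x + y).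
    move=> /vP[w [i [l [uw e ->]]]] /vP[w' [i' [l' [uw' e' ->]]]] xy le.
    have {}le : (i + l' <= i' + l)%N by lia.
    (* Over the common denominator [p ^+ (l + l')], the smaller power [p ^+ (i + l')] factors out of
       the numerator. *)
    have exy : (x + y) * j (p ^+ (l + l')) =
        j ((w + w' * p ^+ (i' + l - (i + l'))) * p ^+ (i + l')).
      rewrite [in RHS]mulrDl -[w' * _ * _]mulrA -exprD subnK //.
      rewrite [in LHS]exprD rmorphM rmorphD /= !exprD !mulrA.
      rewrite !(rmorphM j (_ * _)) /= -e -e'; ring.
    have /p_factor[u [k [uu eu]]] : w + w' * p ^+ (i' + l - (i + l')) != 0.
      apply: contraNneq xy => e0; rewrite e0 mul0r rmorph0 in exy.
      by apply/eqP/(@j_cancel (l + l')); rewrite exy mul0r.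
    rewrite (vE (x + y) ((k + (i + l'))%:Z - (l + l')%:Z)); first by lia.
    by exists u, (k + (i + l'))%N, (l + l')%N; split=> //; rewrite exy eu -mulrA -exprD.
  move=> x y x0 y0 xy; case: (leP (v x) (v y)) => [le|/ltW le].
    exact: (add x y x0 y0 xy le).
  rewrite addrC in xy *; exact: (add y x y0 x0 xy le).
- exact: vj.
- move=> x; split=> [[r ->]|[->|]].
  + have [->|r0] := eqVneq r 0; [by left; rewrite rmorph0|right].
    by have [w [k [uw ->]]] := p_factor r0; rewrite vj.
  + by exists 0; rewrite rmorph0.
  + have [->|/vP[w [i [l [uw e ->]]]] le] := eqVneq x 0.
      by exists 0; rewrite rmorph0.
    have {}le : (l <= i)%N by lia.
    exists (w * p ^+ (i - l)); apply: (@j_cancel l).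
    by rewrite e -rmorphM -mulrA -exprD subnK.
Qed.

End UniformizerValuation.

(** * Elements whose singular locus has codimension at least two *)

Section CodimensionTwo.
Variables (R : comPzRingType) (hR : noetherian R) (D : R).
Hypothesis nzdD : nonzerodiv D.
Hypothesis codimD : codim_ge (Vsing D) 2.

Lemma nonunits_toloc (P : spec R) a :
  prime_set P a -> nonunits (toloc (prime_compl P) a).
Proof.
move=> Pa [y]; have [b [s [ns ->]]] := locP y.
rewrite -[_ * _]/(loc_mul _ _) loc_mulE => /mkloc_eqP[u nu].
rewrite mulr1 !mul1r => e; apply: (primeM nu ns).
by rewrite -e mulrCA mulrC; apply: primeMl.
Qed.

Lemma nonunitsM (S : comPzRingType) (x y : S) : nonunits x -> nonunits (x * y).
Proof. by move=> nx [z e]; apply: nx; exists (y * z); rewrite mulrA. Qed.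

Lemma ideal_mul2 (S : comPzRingType) (I J : set S) x y :
  I x -> J y -> ideal_set (ideal_mul I J) (x * y).
Proof.
move=> Ix Jy; exists 1%N, (fun=> 1), (fun=> x * y).
by split=> [_|]; [exists x, y|rewrite big_ord1 mul1r].
Qed.

Lemma nonzerodiv_lzero (P : spec R) : ~ lzero P D.
Proof.
move=> [s ns]; rewrite mulrC => /nzdD s0; apply: ns; rewrite s0; exact: prime0.
Qed.

(* An associated prime [Q] of [D R_P : t] is locally principal, so of height at
   most 1, but [D] would lie in the square of its maximal ideal. *)
Lemma ldvd_sqr (P : spec R) t c : normal_domain (local_ring P) ->
  t * t = D * c -> ldvd P D t.
Proof.
move=> nP ett; apply: contrapT => ndt.
have [Q [x [q [s [u [QP [r xrt] QE [Qq ns nu e] prinQ]]]]]] :=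
  associated_prime hR nP (@nonzerodiv_lzero P) ndt.
apply: (locally_principal_height hR Qq prinQ); apply: codimD.
(* As [x] is a multiple of [t], its square is a multiple of [D]. *)
have Qx : prime_set Q x.
  apply/QE; exists 1, (r * r * c); split; first exact: prime1.
  by rewrite xrt mul1r mulrACA ett; ring.
have [w uw] := toloc_unit nu.
(* In [R_Q] this reads [D = (s * q) * (x / u)], with [q] and [x] both in [Q]. *)
rewrite /Vsing /= -[toloc _ D]mulr1 -uw mulrA -rmorphM -e rmorphM -mulrA.
apply: ideal_mul2; last by apply: nonunitsM; apply: nonunits_toloc.
by apply: nonunits_toloc; apply: primeMl.
Qed.

Lemma squarefree_codim2 : normal_ring R -> squarefree D.
Proof.
move=> nR P hP; have nP := nR P.
have [q Pq prin] := height1_locally_principal hR nP hP.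
pose i : {rmorphism R -> local_ring P} := toloc (prime_compl P).
have iq0 : i q != 0.
  apply/eqP => /toloc_eq0[s ns sq0].
  have [[C [C1 Clt]] _] := hP.
  have [le01 /existsNP[d /not_implyP[]]] := Clt 0%N isT; rewrite C1 => Pd nd.
  have [v [c [nv e]]] := prin d Pd.
  have /prime_or[Cs|//] : prime_set (C 0%N) ((s * v) * d).
    by rewrite -mulrA e mulrCA sq0 mulr0; apply: prime0.
  by apply: (primeM ns nv); rewrite -C1; apply: le01.
(* An element of [R_P] that is not a unit times a power of [q] is [q] times another such element, so
   Krull's intersection makes it zero. *)
have factor a : ~ lzero P a -> exists v w k,
    [/\ ~ prime_set P v, ~ prime_set P w & v * a = w * q ^+ k].
  move=> nz; apply: contrapT => none; apply: nz.
  apply: (krull_intersection hR Pq (C := fun a => ~ exists v w k,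
    [/\ ~ prime_set P v, ~ prime_set P w & v * a = w * q ^+ k])) => // b nb.
  have [Pb|nPb] := EM (prime_set P b); last first.
    case: nb; exists 1, b, 0%N; split=> //; first exact: prime1.
    by rewrite mul1r mulr1.
  have [v [c [nv e]]] := prin b Pb; exists v, c; split=> // -[v' [w [k [nv' nw e']]]].
  apply: nb; exists (v' * v), w, k.+1; split=> //; first exact: primeM.
  by rewrite -mulrA e mulrA e' exprSr mulrA.
have ifactor x : x != 0 -> exists w k, (exists y, w * y = 1) /\ x = w * i q ^+ k.
  have [a [s [ns ->]]] := locP x => x0.
  have [y ey] := toloc_unit ns.
  have xs : @mkloc _ (prime_compl P) a s ns = i a * y.
    have <- : @mkloc _ (prime_compl P) a s ns * i s = i a.
      rewrite -[LHS]/(loc_mul _ _) loc_mulE.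
      by apply/mkloc_eqP; exists 1; [exact: prime1|ring].
    by rewrite -mulrA ey mulr1.
  have [|v [w [k [nv nw e]]]] := factor a.
    by move=> /toloc_eq0 a0; rewrite xs [i a]a0 mul0r eqxx in x0.
  have [v' ev] := toloc_unit nv; have [w' ew] := toloc_unit nw.
  exists (i w * (v' * y)), k; split.
    exists (w' * (i v * i s)).
    transitivity ((i w * w') * (i v * v') * (i s * y)); first by ring.
    by rewrite ew ev ey !mulr1.
  have -> : i w * (v' * y) * i q ^+ k = i (v * a) * (v' * y).
    by rewrite e rmorphM rmorphXn; ring.
  rewrite xs rmorphM; transitivity (i a * y * (i v * v')); last by ring.
  by rewrite ev mulr1.
have [v [vM vD vj v_ge0]] := uniformizer_valuation (proj1 nP) iq0
  (nonunits_toloc Pq) ifactor.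
exists v; first split=> //.
  exists (toloc _ (1 * i q ^+ 1)); last first.
    by rewrite vj //; exists 1; rewrite mulr1.
  rewrite mul1r; apply: contraNneq iq0 => e; apply/eqP; apply: tofrac_inj.
  by rewrite e rmorph0.
have iD0 : i D != 0 by apply/eqP => /toloc_eq0; apply: nonzerodiv_lzero.
split.
  by apply: contraNneq iD0 => e; apply/eqP; apply: tofrac_inj; rewrite e rmorph0.
rewrite -/i; have [w [k [uw iDE]]] := ifactor _ iD0.
rewrite {1 2}iDE !vj //; case: k iDE => [|[|k iDE]]; [by left|by right|].
(* An exponent of at least two would put [D] in the square of the maximal ideal, hence give [P]
   height at least two. *)
case: hP => _ []; apply: codimD.
rewrite /Vsing /= -/i iDE exprS mulrCA; apply: ideal_mul2.
  exact: nonunits_toloc.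
rewrite mulrC exprS -mulrA; apply: nonunitsM; exact: nonunits_toloc.
Qed.

End CodimensionTwo.

(** * Normality of Frobenius algebras *)

Lemma loc_fraction (R : comPzRingType) (S : multset R) (x : loc S) :
  exists a s, mult_set S s /\ toloc S s * x = toloc S a.
Proof.
have [a [s [Ss ->]]] := locP x; exists a, s; split=> //.
rewrite -[LHS]/(loc_mul _ _) loc_mulE.
by apply/mkloc_eqP; exists 1; [exact: multset1|ring].
Qed.

Section FrobeniusAlgebra.
Variables (A : comNzRingType) (B : comPzRingType) (i : {rmorphism A -> B}).
Variables (T : B -> A) (I : finType) (b b' : I -> B) (w : B).
Hypothesis TZ : forall a x, T (i a * x) = a * T x.
Hypothesis dual_basis : forall x, x = \sum_j i (T (x * b' j)) * b j.
Hypothesis Tw : T w = 1.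
Variables (G : finType) (act : G -> {rmorphism B -> B}) (sg : G -> B).
Variables (J : B) (D : A).
Hypothesis act_i : forall g a, act g (i a) = i a.
Hypothesis alternate : forall x, \sum_g sg g * act g x = J * i (T x).
Hypothesis J2 : J ^+ 2 = i D.

Hypothesis hA : noetherian A.
Hypothesis nA : normal_ring A.
Hypothesis nzdD : nonzerodiv D.
Hypothesis codimD : codim_ge (Vsing D) 2.

Variable Q : spec B.

Lemma preim_prime : is_prime [set a | prime_set Q (i a)].
Proof.
split; first split.
- by rewrite /= rmorph0; apply: prime0.
- by move=> x y /= Qx Qy; rewrite rmorphD; apply: primeD.
- by move=> a x /= Qx; rewrite rmorphM; apply: primeMl.
- by rewrite /= rmorph1; apply: prime1.
- by move=> x y /=; rewrite rmorphM; apply: prime_or.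
Qed.

Let P := Spec preim_prime.

Let nP : normal_domain (local_ring P). Proof. exact: nA. Qed.

(** [bdvd] and [bzero] are divisibility and vanishing in [B_P], where only elements of [A] outside
    [P], the trace of [Q] on [A], are inverted. *)
Let bdvd (d : A) (x : B) := exists s y, ~ prime_set P s /\ i s * x = i d * y.
Let bzero (x : B) := exists2 s, ~ prime_set P s & i s * x = 0.

Let bzeroQ x : bzero x -> lzero Q x.
Proof. by move=> [s ns e]; exists (i s). Qed.

Let T0 : T 0 = 0. Proof. by rewrite -(mulr0 (i 0)) TZ mul0r. Qed.

(** The coordinates of [x] in the family [b] are the values [T (x * b' j)]; the product of their
    finitely many denominators serves for [x]. *)
Let bdvd_T d x : (forall y, ldvd P d (T (x * y))) -> bdvd d x.
Proof.
move=> /choice[s] /choice[c sc].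
pose S := \prod_j s (b' j); pose S' j := \prod_(k | k != j) s (b' k).
exists S, (\sum_j i (S' j * c (b' j)) * b j); split.
  by apply: prime_prod => j; case: (sc (b' j)).
rewrite {1}[x]dual_basis !mulr_sumr; apply: eq_bigr => j _.
rewrite !mulrA -!rmorphM; congr (i _ * _).
rewrite /S (bigD1 j) //= -/(S' j) mulrAC (proj2 (sc _)); ring.
Qed.

Let bzero_T x : (forall y, lzero P (T (x * y))) -> bzero x.
Proof.
move=> z0; have [|s [y [ns e]]] := @bdvd_T 0 x.
  by move=> y; have [s ns e] := z0 y; exists s, 0; rewrite mul0r.
by exists s; rewrite // e rmorph0 mul0r.
Qed.

Let bzero_dom c x : ~ lzero P c -> bzero (i c * x) -> bzero x.
Proof.
move=> nc [s ns e]; apply: bzero_T => y; apply: (lzero_dom nP nc).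
exists s => //; rewrite -TZ -TZ.
have -> : i s * (i c * (x * y)) = i s * (i c * x) * y by ring.
by rewrite e mul0r T0.
Qed.

Let bdvdD d x y : bdvd d x -> bdvd d y -> bdvd d (x + y).
Proof.
move=> [s [z [ns e]]] [s' [z' [ns' e']]].
exists (s * s'), (i s' * z + i s * z'); split; first exact: primeM.
rewrite rmorphM; transitivity (i s' * (i s * x) + i s * (i s' * y)); first by ring.
by rewrite e e'; ring.
Qed.

Let bdvd0 d : bdvd d 0.
Proof. by exists 1, 0; split; [exact: prime1|rewrite !mulr0]. Qed.

Let bdvdM d d' x y : bdvd d x -> bdvd d' y -> bdvd (d * d') (x * y).
Proof.
move=> [s [z [ns e]]] [s' [z' [ns' e']]].
exists (s * s'), (z * z'); split; first exact: primeM.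
by rewrite !rmorphM /= mulrACA e e' mulrACA.
Qed.

Let bdvdMr d x y : bdvd d x -> bdvd d (x * y).
Proof. by move=> [s [z [ns e]]]; exists s, (z * y); rewrite !mulrA e. Qed.

(* [x / d] is almost integral over [B_P]. *)
Let almost_integral (d : A) (x : B) :=
  exists2 c, ~ lzero P c & forall k, bdvd (d ^+ k) (i c * x ^+ k).

Let nlzero1 : ~ lzero P 1. Proof. apply: lzero_notin; exact: prime1. Qed.

Let almost_integral0 d : almost_integral d 0.
Proof.
exists 1 => // k; case: k => [|k]; last by rewrite expr0n mulr0; apply: bdvd0.
by exists 1, 1; split; [exact: prime1|rewrite !expr0 rmorph1; ring].
Qed.

Let almost_integralD d x y :
  almost_integral d x -> almost_integral d y -> almost_integral d (x + y).
Proof.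
move=> [c nc dx] [c' nc' dy]; exists (c * c'); first exact: (lzeroM nP).
move=> k; rewrite exprDn mulr_sumr.
elim/big_ind: _ => [||j _]; [exact: bdvd0|exact: bdvdD|].
have jk : (j <= k)%N by rewrite -ltnS.
rewrite -[in d ^+ k](subnK jk) exprD.
have := bdvdMr ('C(k, j)%:R) (bdvdM (dx (k - j)%N) (dy j)).
by rewrite mulr_natr mulrACA -rmorphM -!mulrnAr.
Qed.

Let almost_integralMl d x y : almost_integral d x -> almost_integral d (y * x).
Proof.
move=> [c nc dx]; exists c => // k.
by rewrite exprMn mulrCA mulrC; apply: bdvdMr.
Qed.

Let almost_integral_act d g x : almost_integral d x -> almost_integral d (act g x).
Proof.
move=> [c nc dx]; exists c => // k; have [s [y [ns e]]] := dx k.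
exists s, (act g y); split=> //.
by rewrite -[in LHS](act_i g s) -[in LHS](act_i g c) -[in RHS](act_i g) -rmorphXn -!rmorphM e.
Qed.

Let almost_integral_alt d x : almost_integral d x -> almost_integral d (J * i (T x)).
Proof.
move=> dx; rewrite -alternate; elim/big_ind: _ => [||g _].
- exact: almost_integral0.
- exact: almost_integralD.
exact/almost_integralMl/almost_integral_act.
Qed.

Let nD : ~ lzero P D. Proof. exact: nonzerodiv_lzero. Qed.

(* If [x / d] is integral, so is [J t / d] with [t = T (x z)]; its square
   [D t^2 / d^2] and hence [D t / d] lie in [A_P], and [D] divides the square of
   the latter, so [D] divides it. *)
Lemma bdvd_almost_integral d x : ~ lzero P d -> almost_integral d x -> bdvd d x.
Proof.
move=> nd dx; apply: bdvd_T => z; set t := T (x * z).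
have [c nc dJt] : almost_integral d (J * i t).
  by apply: almost_integral_alt; rewrite mulrC; apply: almost_integralMl.
(* Even powers of [J * i t] are powers of [D * t ^+ 2]. Since [T w = 1], multiplying by [w] and
   applying [T] brings their divisibility from [B] down to [A]. *)
have [|s [a [ns ea]]] := @ldvd_completely_integral _ _ nP hA (d ^+ 2) c (D * t ^+ 2)
    (lzeroX nP nd) nc.
  move=> k; have [s [y [ns e]]] := dJt (2 * k)%N.
  exists s, (T (y * w)); split=> //.
  have JtE : (J * i t) ^+ (2 * k) = i ((D * t ^+ 2) ^+ k).
    by rewrite exprM (exprMn 2 J) J2 -rmorphXn -rmorphM -rmorphXn.
  have {}e : i (s * (c * (D * t ^+ 2) ^+ k)) = i (d ^+ (2 * k)) * y.
    by rewrite -e JtE !rmorphM.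
  by rewrite -exprM -TZ [i _ * _]mulrA -e TZ Tw mulr1.
have [s1 [a1 [ns1 ea1]]] : ldvd P d (D * t).
  (* [D * t / d] is a root of [X^2 - D * a / s]. *)
  apply: (@ldvd_integral _ _ nP d (D * t) s 2 (fun k => if k is 0 then D * a else 0)) => //.
  rewrite !big_ord_recl big_ord0 /=; transitivity (D * (s * (D * t ^+ 2))); first by ring.
  by rewrite ea; ring.
have nd2 := lzeroX nP (k := 2) nd.
have /(lzero_dom nP nd2)/lzero_eq[s2 ns2 e2] :
    lzero P (d ^+ 2 * (s * a1 ^+ 2 - s1 ^+ 2 * D * a)).
  exists 1; first exact: prime1.
  transitivity (s * (d * a1) ^+ 2 - s1 ^+ 2 * D * (d ^+ 2 * a)); first by ring.
  by rewrite -ea -ea1; ring.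
(* Here [a1 / s1] is [D * t / d], whose square is a multiple of [D]; the factor [s2 * s] makes the
   square a multiple of [D] in [A] itself. *)
have [s3 [a3 [ns3 e3]]] : ldvd P D (s2 * s * a1).
  apply: (ldvd_sqr hA nzdD codimD (c := s2 * s * s2 * s1 ^+ 2 * a)) => //.
  transitivity (s2 * s * (s2 * (s * a1 ^+ 2))); first by ring.
  by rewrite e2; ring.
have /(lzero_dom nP nD)/lzero_eq[s4 ns4 e4] :
    lzero P (D * (s3 * s2 * s * s1 * t - d * a3)).
  exists 1; first exact: prime1.
  transitivity (s3 * s2 * s * (s1 * (D * t)) - d * (D * a3)); first by ring.
  by rewrite -e3 ea1; ring.
exists (s4 * (s3 * s2 * s * s1)), (s4 * a3); split.
  by do 4?[apply: primeM => //].
by rewrite -mulrA e4; ring.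
Qed.

(** The finitely many [b j] generate [B] over [A], so Cayley-Hamilton applies to a matrix of
    multiplication by [x] on them. *)
Lemma monic_relation x : exists m (a : nat -> A),
  a m = 1 /\ \sum_(k < m.+1) i (a k) * x ^+ k = 0.
Proof.
suff [p [mon p0]] : exists p : {poly A}, p \is monic /\
    forall y, (\sum_(k < size p) i p`_k * x ^+ k) * y = 0.
  have sp : size p = (size p).-1.+1.
    by rewrite prednK // lt0n size_poly_eq0 monic_neq0.
  exists (size p).-1, (fun k => p`_k); split; first exact/eqP.
  by rewrite -sp -[LHS]mulr1.
have [n e] : {n | #|I| = n} by exists #|I|.
case: n => [|n] in e *.
  exists 1; rewrite monic1; split=> // y.
  have -> : y = 0 by rewrite [y]dual_basis big1 // => j _; have := fintype0 j e.
  by rewrite mulr0.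
pose c (k : 'I_n.+1) := b (enum_val (cast_ord (esym e) k)).
pose M := \matrix_(k < n.+1, l < n.+1)
  T (x * c k * b' (enum_val (cast_ord (esym e) l))).
have basis y : y = \sum_l i (T (y * b' (enum_val (cast_ord (esym e) l)))) * c l.
  rewrite {1}[y]dual_basis (reindex (fun l => enum_val (cast_ord (esym e) l))) //.
  exists (fun j => cast_ord e (enum_rank j)) => j _.
    by rewrite enum_valK cast_ordKV.
  by rewrite cast_ordK enum_rankK.
have xc k l : x ^+ k * c l = \sum_m i ((M ^+ k) l m) * c m.
  elim: k l => [|k IH] l.
    rewrite !expr0 mul1r (bigD1 l) //= mxE eqxx rmorph1 mul1r big1 ?addr0 // => m ml.
    by rewrite mxE eq_sym (negPf ml) rmorph0 mul0r.
  rewrite exprSr -mulrA [x * c l]basis mulr_sumr.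
  transitivity (\sum_m i (M l m) * \sum_q i ((M ^+ k) m q) * c q).
    by apply: eq_bigr => m _; rewrite mulrCA IH mxE.
  under eq_bigr do rewrite mulr_sumr.
  rewrite exchange_big; apply: eq_bigr => q _.
  rewrite exprS -[M * _]/(M *m _) mxE rmorph_sum mulr_suml; apply: eq_bigr => m _.
  by rewrite mulrA rmorphM.
exists (char_poly M); split; first exact: char_poly_monic.
move=> y; rewrite [y]basis mulr_sumr big1 // => l _; rewrite mulrCA.
suff -> : (\sum_(k < size (char_poly M)) i (char_poly M)`_k * x ^+ k) * c l = 0.
  by rewrite mulr0.
have : horner_mx M (char_poly M) = 0 := Cayley_Hamilton M.
rewrite -{1}[char_poly M]coefK poly_def rmorph_sum /= => CH.
rewrite mulr_suml.
transitivity (\sum_m i ((\sum_(k < size (char_poly M))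
    horner_mx M ((char_poly M)`_k *: 'X^k)) l m) * c m); last first.
  by rewrite CH big1 // => m _; rewrite mxE rmorph0 mul0r.
under eq_bigr do rewrite -mulrA xc mulr_sumr.
rewrite exchange_big; apply: eq_bigr => m _.
rewrite summxE rmorph_sum mulr_suml; apply: eq_bigr => k _.
by rewrite linearZ rmorphXn /= horner_mx_X mxE rmorphM mulrA.
Qed.

Let nilpotent (x : B) := exists m, x ^+ m = 0.

Let nilpotentMl x y : nilpotent x -> nilpotent (y * x).
Proof. by move=> [m e]; exists m; rewrite exprMn e mulr0. Qed.

Let nilpotentD x y : nilpotent x -> nilpotent y -> nilpotent (x + y).
Proof.
move=> [m ex] [k ey]; exists (m + k)%N; rewrite exprDn big1 // => j _.
case: (leqP k j) => [/subnK <-|jk]; first by rewrite exprD ey !mulr0 mul0rn.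
have /subnK <- : (m <= m + k - j)%N by rewrite -addnBA ?leq_addr // ltnW.
by rewrite exprD ex !mulr0 mul0r mul0rn.
Qed.

(** For [t = T (x * y)], the element [J * i t] is a sum of multiples of conjugates of [x * y], so it
    is nilpotent, and so is its square [D * t ^+ 2]. In the domain [A_P] this forces [t = 0]. *)
Lemma bzero_nilpotent x : nilpotent x -> bzero x.
Proof.
move=> [m xm]; apply: bzero_T => y; set t := T (x * y).
have [k Jt] : nilpotent (J * i t).
  rewrite -alternate; elim/big_ind: _ => [||g _].
  - by exists 1%N; rewrite expr1.
  - exact: nilpotentD.
  apply: nilpotentMl; exists m.
  by rewrite rmorphM exprMn -rmorphXn xm rmorph0 mul0r.
apply: contrapT => nt.
apply: (lzeroX nP (k := k) (lzeroM nP nD (lzeroX nP (k := 2) nt))).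
exists 1; first exact: prime1.
have e : i ((D * t ^+ 2) ^+ k) = 0.
  by rewrite rmorphXn rmorphM rmorphXn /= -J2 -exprMn -exprM mulnC exprM Jt expr0n.
by rewrite mul1r -[LHS]mulr1 -Tw -TZ e mul0r T0.
Qed.

(** If [a k] is the first coefficient of a monic relation that is nonzero in [A_P], then
    [x ^+ k * (a k + x * z) = 0] in [B_P]. So [x * (a k + x * z)] is nilpotent there, hence zero. *)
Lemma von_neumann_regular x : exists c y, ~ lzero P c /\ bzero (i c * x - x ^+ 2 * y).
Proof.
have [m [a [am e]]] := monic_relation x.
have : exists k, `[< ~ lzero P (a k) >] by exists m; apply/asboolP; rewrite am.
case/ex_minnP => k /asboolP nk kmin.
have km : (k <= m)%N by apply: kmin; apply/asboolP; rewrite am.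
have /choice[s sP] : forall l : 'I_k, exists s, ~ prime_set P s /\ s * a l = 0.
  move=> l; apply: contrapT => ns; have := kmin l; rewrite leqNgt ltn_ord.
  move=> /(_ _)/notF; apply; apply/asboolP => -[s ns' es].
  by apply: ns; exists s.
pose S := \prod_l s l.
have nS : ~ prime_set P S by apply: prime_prod => l; case: (sP l).
pose z := \sum_(k.+1 <= l < m.+1) i (a l) * x ^+ (l - k.+1).
have eS : i S * x ^+ k * (i (a k) + x * z) = 0.
  move: e; rewrite -(big_mkord xpredT (fun l => i (a l) * x ^+ l)).
  rewrite (big_cat_nat (n := k)) //=; last by rewrite ltnW.
  move=> /(congr1 ( *%R (i S))); rewrite mulrDr mulr0.
  rewrite big_mkord mulr_sumr big1 ?add0r => [|l _]; last first.
    rewrite mulrA -rmorphM /S (bigD1 l) //= mulrAC (proj2 (sP l)) mul0r rmorph0.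
    by rewrite mul0r.
  rewrite big_ltn ?ltnS // => <-; rewrite -mulrA; congr (_ * _).
  rewrite mulrDr mulrC; congr (_ + _).
  rewrite /z !mulr_sumr; apply: eq_big_nat => l /andP[kl _].
  have -> : x ^+ l = x ^+ k.+1 * x ^+ (l - k.+1) by rewrite -exprD subnKC.
  by rewrite exprS; ring.
have [s0 ns0 es0] : bzero (i S * x * (i (a k) + x * z)).
  apply: bzero_nilpotent; exists k.+1.
  transitivity ((i S * x ^+ k * (i (a k) + x * z)) *
      ((i S) ^+ k * x * (i (a k) + x * z) ^+ k)); last by rewrite eS mul0r.
  by rewrite !exprMn !exprS; ring.
exists (a k), (- z); split=> //.
exists (s0 * S); first exact: primeM.
by rewrite rmorphM -es0; ring.
Qed.

(* Up to units of [A_P], [e / s] is the idempotent generating the ideal [x]. *)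
Lemma support_idempotent x : exists c s e y,
  [/\ ~ lzero P c, ~ prime_set P s, i s * (x * y) = i c * e,
      bzero (e * (e - i s)) & bzero ((e - i s) * x)].
Proof.
have [c [y [nc [s0 ns0 e0]]]] := von_neumann_regular x.
have E0 : i s0 * (x * y) ^+ 2 = i s0 * (i c * (x * y)).
  apply/eqP; rewrite -subr_eq0; apply/eqP.
  by rewrite -[RHS](mul0r (- y)) -e0; ring.
(* [x * y / c] is idempotent, so its powers have the common denominator [c], and it lies in
   [B_P]. *)
have [|s [e [ns es]]] := bdvd_almost_integral nc (x := x * y).
  have EX k : exists2 s1, ~ prime_set P s1 &
      i s1 * (x * y) ^+ k.+1 = i s1 * (i c ^+ k * (x * y)).
    elim: k => [|k [s1 ns1 e1]].
      by exists 1; [exact: prime1|rewrite expr0 expr1 mul1r].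
    exists (s1 * s0); first exact: primeM.
    rewrite exprSr rmorphM.
    transitivity (i s0 * (i s1 * (x * y) ^+ k.+1) * (x * y)); first by ring.
    rewrite e1; transitivity (i s1 * i c ^+ k * (i s0 * (x * y) ^+ 2)); first by ring.
    by rewrite E0 exprS; ring.
  exists c => // -[|k].
    by exists 1, (i c); split; [exact: prime1|rewrite !expr0 rmorph1; ring].
  have [s1 ns1 e1] := EX k; exists s1, (i s1 * (x * y)); split=> //.
  transitivity (i c * (i s1 * (x * y) ^+ k.+1)); first by ring.
  by rewrite e1 exprS rmorphM rmorphXn; ring.
exists c, s, e, y; split=> //.
- apply: (bzero_dom nc); apply: (bzero_dom nc); exists s0 => //.
  transitivity (i s0 * ((i c * e) ^+ 2 - i c * i s * (i c * e))); first by ring.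
  rewrite -es; transitivity (i s ^+ 2 * (i s0 * (x * y) ^+ 2 - i s0 * (i c * (x * y)))).
    by ring.
  by rewrite E0 subrr mulr0.
- apply: (bzero_dom nc); exists s0 => //.
  transitivity (i s0 * ((i c * e) * x - i s * i c * x)); first by ring.
  rewrite -es; transitivity (- i s * (i s0 * (i c * x - x ^+ 2 * y))); first by ring.
  by rewrite e0 mulr0.
Qed.

(** [Q] contains at most one of the idempotent [e / s] and its complement. The complement kills
    [u * x]; the idempotent is a multiple of [u * x] up to [c], so it kills [y]. One of them is
    invertible at [Q]. *)
Lemma lzeroQ_or x y : lzero Q (x * y) -> lzero Q x \/ lzero Q y.
Proof.
move=> [u nu uxy].
have [c [s [e [z [nc ns es e2 [u0 nu0 ex]]]]]] := support_idempotent (u * x).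
have [Qe|nQe] := EM (prime_set Q e); [left|right].
  exists (i u0 * (e - i s) * u); last by rewrite -ex; ring.
  apply: primeM => //; apply: primeM => // Qes; apply: ns => /=.
  by rewrite -[i s](subKr e); apply/primeD/primeN.
have /(bzero_dom nc)/bzeroQ[v nv ev] : bzero (i c * (e * y)).
  exists 1; first exact: prime1.
  rewrite rmorph1 mul1r mulrA -es; transitivity (i s * z * (u * (x * y))); first by ring.
  by rewrite uxy mulr0.
by exists (v * e); [exact: primeM|rewrite -mulrA].
Qed.

(** An integral equation of degree [m] for [x / d] bounds the denominators of all its powers by
    [d ^+ m]. *)
Let almost_integral_monic d x m (r : nat -> B) : ~ lzero P d ->
  x ^+ m = \sum_(k < m) r k * (x ^+ k * i d ^+ (m - k)) -> almost_integral d x.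
Proof.
move=> nd e; exists (d ^+ m); first exact: (lzeroX nP).
suff dvd k : exists y, i d ^+ m * x ^+ k = i d ^+ k * y.
  move=> k; have [y ey] := dvd k; exists 1, y; split; first exact: prime1.
  by rewrite rmorph1 mul1r !rmorphXn.
elim/ltn_ind: k => k IH; case: (leqP m k) => [mk|/ltnW km]; last first.
  exists (i d ^+ (m - k) * x ^+ k).
  by rewrite mulrA -exprD subnKC.
have /choice[y yP] : forall l : 'I_m, exists y,
    i d ^+ m * x ^+ (k - m + l) = i d ^+ (k - m + l) * y.
  by move=> l; apply: IH; rewrite -[ltnRHS](subnK mk) ltn_add2l.
exists (\sum_(l < m) r l * y l).
rewrite -[in x ^+ k](subnK mk) exprD e !mulr_sumr; apply: eq_bigr => l _.
transitivity (r l * i d ^+ (m - l) * (i d ^+ m * x ^+ (k - m + l))).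
  by rewrite [x ^+ (_ + l)]exprD; ring.
rewrite yP.
have -> : i d ^+ k = i d ^+ (m - l) * i d ^+ (k - m + l).
  by rewrite -exprD addnCA subnK ?subnK // ltnW.
by ring.
Qed.

Let iQ : {rmorphism B -> local_ring Q} := toloc (prime_compl Q).
Let jQ : {rmorphism local_ring Q -> totfrac (local_ring Q)} :=
  toloc (nonzerodivs (local_ring Q)).

Let domQ (x y : local_ring Q) : x * y = 0 -> x = 0 \/ y = 0.
Proof.
have [a [s [ns ea]]] := loc_fraction x; have [d [t [nt eb]]] := loc_fraction y.
have [s' es] := toloc_unit ns; have [t' et] := toloc_unit nt.
move=> xy; have /toloc_eq0/lzeroQ_or[/toloc_eq0 a0|/toloc_eq0 b0] :
    toloc (prime_compl Q) (a * d) = 0.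
  by rewrite rmorphM /= -ea -eb mulrACA xy mulr0.
- by left; rewrite -[x]mul1r -es mulrAC ea a0 mul0r.
- by right; rewrite -[y]mul1r -et mulrAC eb b0 mul0r.
Qed.

(** Clearing the denominators of the coefficients leaves a leading coefficient outside [Q]; scaling
    [x] by it makes the equation monic over [B]. *)
Lemma monic_fraction (z : totfrac (local_ring Q)) x y :
  integralOver jQ z -> ~ lzero Q y -> z * jQ (iQ y) = jQ (iQ x) ->
  exists u m (r : nat -> B), ~ prime_set Q u /\
    (u * x) ^+ m = \sum_(k < m) r k * ((u * x) ^+ k * y ^+ (m - k)).
Proof.
move=> [p mon_p /rootP pz] ny ezy.
have sp : size p = (size p).-1.+1.
  by rewrite prednK // lt0n size_poly_eq0 monic_neq0.
move: (size p).-1 sp => m sp.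
have /choice[v] : forall k, exists v, exists c, ~ prime_set Q v /\ iQ v * p`_k = iQ c.
  by move=> k; have [c [v [nv e]]] := loc_fraction p`_k; exists v, c.
move=> /choice[c cP].
pose V := \prod_(k < m) v k; pose V' (k : nat) := \prod_(l < m | l != k :> nat) v l.
have nV : ~ prime_set Q V by apply: prime_prod => k; case: (cP k).
have : jQ (iQ (V * x ^+ m + \sum_(k < m) V' k * c k * (x ^+ k * y ^+ (m - k)))) = 0.
  transitivity (jQ (iQ (V * y ^+ m)) * (map_poly jQ p).[z]); last by rewrite pz mulr0.
  have -> : (map_poly jQ p).[z] = \sum_(k < m.+1) jQ p`_k * z ^+ k.
    rewrite (@horner_coef_wide _ m.+1) ?size_map_inj_poly ?sp ?rmorph0 //.
      by apply: eq_bigr => k _; rewrite coef_map.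
    exact: tofrac_inj.
  rewrite big_ord_recr /= mulrDr addrC !(rmorphD jQ, rmorphD iQ) /=; congr (_ + _).
    rewrite !rmorph_sum mulr_sumr; apply: eq_bigr => k _.
    have -> : y ^+ m = y ^+ k * y ^+ (m - k) by rewrite -exprD subnKC // ltnW.
    rewrite /V (bigD1 k) //= -/(V' k).
    transitivity (jQ (iQ (V' k)) * jQ (iQ (v k) * p`_k) *
        ((z * jQ (iQ y)) ^+ k * jQ (iQ (y ^+ (m - k))))).
      by rewrite (proj2 (cP k)) ezy !(rmorphM, rmorphXn).
    by rewrite exprMn !(rmorphM, rmorphXn) /=; ring.
  have -> : p`_m = 1 by have /eqP := mon_p; rewrite /lead_coef sp.
  transitivity (jQ (iQ V) * (z * jQ (iQ y)) ^+ m).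
    by rewrite ezy !(rmorphM, rmorphXn).
  by rewrite exprMn !(rmorphM, rmorphXn, rmorph1) /=; ring.
rewrite -(rmorph0 jQ) => /tofrac_inj/toloc_eq0[u nu].
rewrite mulrDr mulr_sumr => /addr0_eq/(congr1 -%R); rewrite opprK => e.
have nuV : ~ prime_set Q (u * V) by apply: primeM.
(* The equation is multiplied by [(u * V) ^+ m.-1], of which the power [k] is absorbed in
   [(u * V * x) ^+ k]. For [m = 0] it would read [u * V = 0], although [u * V] is outside [Q]. *)
exists (u * V), m, (fun k => - ((u * V) ^+ (m.-1 - k) * u * (V' k * c k))); split=> //.
have [m0|m_gt0] := posnP m.
  by case: nuV; rewrite -[V]mulr1 -(expr0 x) -m0 e m0 big_ord0 oppr0; apply: prime0.
transitivity ((u * V) ^+ m.-1 * (u * (V * x ^+ m))).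
  by rewrite exprMn -[in (u * V) ^+ m](prednK m_gt0) exprSr; ring.
rewrite e mulrN mulr_sumr -sumrN; apply: eq_bigr => k _ /=.
have -> : (u * V) ^+ m.-1 = (u * V) ^+ (m.-1 - k) * (u * V) ^+ k.
  by rewrite -exprD subnK // -ltnS prednK.
by rewrite [(u * V * x) ^+ k]exprMn; ring.
Qed.

(** Write [z = x / y]. The idempotent [f / s] of [y] trades the denominator [y] for [c] in [A]:
    [f * u * z] equals [s * u * x * y' / c], which is integral and so of the form [h / s'] in [B_P].
    As [f] is outside [Q], [z] is [h / (s' * f * u)]. *)
Theorem frobenius_normal_domain : normal_domain (local_ring Q).
Proof.
split=> // z intz.
have [X [Y [nzY eXY]]] := loc_fraction z.
have [x0 [s1 [ns1 ex]]] := loc_fraction X; have [y0 [s2 [ns2 ey]]] := loc_fraction Y.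
pose x := x0 * s2; pose y := y0 * s1.
have exy : z * jQ (iQ y) = jQ (iQ x).
  rewrite /x /y !(rmorphM iQ) /= -ex -ey !(rmorphM jQ) /= -eXY; ring.
have ny : ~ lzero Q y.
  move=> /toloc_eq0; rewrite rmorphM /= -ey => /domQ[|s10].
    have [s2' es2] := toloc_unit ns2.
    move=> /(congr1 ( *%R s2')); rewrite mulr0 mulrCA mulrA es2 mul1r => Y0.
    by move: (nzY 1); rewrite Y0 mul0r => /(_ erefl)/eqP; rewrite oner_eq0.
  by apply: (lzero_notin ns1); apply/toloc_eq0.
have [u [m [r [nu e]]]] := monic_fraction intz ny exy.
have [c [s [f [y' [nc ns es _ efy]]]]] := support_idempotent y.
have nf : ~ prime_set Q f.
  move=> Qf; have [t nt et] := bzeroQ efy.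
  apply: ny; exists (t * (f - i s)); last by rewrite -mulrA.
  apply: primeM => // Qfs; apply: ns => /=.
  by rewrite -[i s](subKr f); apply/primeD/primeN.
have [s' [h [ns' eh]]] : bdvd c (i s * (u * x * y')).
  apply: (bdvd_almost_integral nc).
  apply: (@almost_integral_monic _ _ m (fun k => r k * f ^+ (m - k))) => //.
  transitivity (i s ^+ m * y' ^+ m * (u * x) ^+ m); first by rewrite !exprMn; ring.
  rewrite e mulr_sumr; apply: eq_bigr => k _.
  have em v : v ^+ m = v ^+ k * v ^+ (m - k) by rewrite -exprD subnKC // ltnW.
  transitivity (r k * (i s * (u * x * y')) ^+ k * (i s * (y * y')) ^+ (m - k)).
    by rewrite !em !exprMn; ring.
  by rewrite es (exprMn (m - k) (i c)); ring.
have /(bzero_dom nc)/bzeroQ/toloc_eq0 e0 : bzero (i c * (h * y - i s' * f * (u * x))).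
  exists 1; first exact: prime1.
  rewrite rmorph1 mul1r mulrBr [i c * (h * y)]mulrA -eh.
  transitivity (i s' * (u * x) * (i s * (y * y') - i c * f)); first by ring.
  by rewrite es subrr mulr0.
have nsfu : ~ prime_set Q (i s' * f * u) by do 2?apply: primeM.
have [t et] : exists t, iQ (i s' * f * u) * t = 1 := toloc_unit nsfu.
exists (iQ h * t).
have /tofrac_unit[y1 ey1] : nonzerodiv (iQ y).
  by move=> v /domQ[/toloc_eq0|].
rewrite -[z]mulr1 -[RHS]mulr1 -ey1 !mulrA exy -(rmorphM jQ); congr (jQ _ * _).
move: e0; rewrite rmorphB => /subr0_eq e0.
by rewrite mulrAC -rmorphM e0 mulrA (rmorphM iQ _ x) mulrAC et mul1r.
Qed.

End FrobeniusAlgebra.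

(** * The linear form on the signed splitting ring *)

Lemma det_row_sum (R : comNzRingType) (n : nat) (K : finType)
    (a : 'I_n -> K -> R) (r : 'I_n -> K -> 'rV[R]_n) :
  \det (\matrix_(i, j) \sum_k a i k * r i k 0 j) =
  \sum_(g : {ffun 'I_n -> K})
     (\prod_i a i (g i)) * \det (\matrix_(i, j) r i (g i) 0 j).
Proof.
rewrite /determinant; under [RHS]eq_bigr do rewrite mulr_sumr.
rewrite [RHS]exchange_big; apply: eq_bigr => s _.
under eq_bigr do rewrite mxE.
rewrite bigA_distr_bigA mulr_sumr; apply: eq_bigr => g _.
rewrite big_split /= mulrCA; congr (_ * (_ * _)).
by apply: eq_bigr => i _; rewrite mxE.
Qed.

Section TopFunctional.
Variables (R : comNzRingType) (n : nat) (p : {poly R}).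

(** Multiplication by [u^2] modulo [p(u^2)] on row vectors of coefficients of [u], [u^3], and so on.
    The size is [n] rather than [(size p).-1], which makes base change free of casts. *)
Definition companion : 'M[R]_n :=
  \matrix_(i, j) if i == n.-1 :> nat then - p`_j else (i.+1 == j :> nat)%:R.

(* The odd part of [u^k mod p(u^2)]: coefficients of [u, u^3, ..., u^(2n-1)]. *)
Fixpoint odd_residue (k : nat) : 'rV[R]_n :=
  match k with
  | 0 => 0
  | 1 => \row_j (j == 0 :> nat)%:R
  | k.+2 => odd_residue k *m companion
  end.

(** The signed alternating sum of a monomial is a determinant of doubled odd powers; reducing its
    rows modulo [p(u^2)] splits off [J] and leaves this factor. *)
Definition top_monomial (m : 'X_{1..n}) : R :=
  \det (\matrix_(i, j) odd_residue (m i) 0 j).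

Lemma odd_residueSS k : odd_residue k.+2 = odd_residue k *m companion.
Proof. by []. Qed.

(* In the splitting ring of [p(u^2)] this is [y |-> (\sum_g sgn(g) g(y)) / J],
   over the signed permutations [g]. *)
Definition top_functional (x : {mpoly R[n]}) : R :=
  \sum_(m <- msupp x) x@_m * top_monomial m.

Lemma top_functionalE k x : (msize x <= k)%N ->
  top_functional x = \sum_(m : 'X_{1..n < k}) x@_m * top_monomial m.
Proof.
move=> le_k; rewrite /top_functional (big_mksub 'X_{1..n < k}) /= ?msupp_uniq //; first last.
  by move=> m /msize_mdeg_lt /leq_trans; apply.
by rewrite big_rmcond //= => m /memN_msupp_eq0 ->; rewrite mul0r.
Qed.

Fact top_functional_linear : linear_for *%R top_functional.
Proof.
move=> c x y; pose k := maxn (maxn (msize x) (msize y)) (msize (c *: x + y)).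
rewrite !(@top_functionalE k) ?leq_max ?leqnn ?orbT //.
rewrite mulr_sumr -big_split; apply: eq_bigr => m _ /=.
by rewrite mcoeffD mcoeffZ; ring.
Qed.
HB.instance Definition _ := GRing.isLinear.Build R {mpoly R[n]} R *%R
  top_functional top_functional_linear.

Lemma top_functionalX m : top_functional 'X_[m] = top_monomial m.
Proof. by rewrite /top_functional msuppX big_seq1 mcoeffX eqxx mul1r. Qed.

Lemma top_functionalCM c x : top_functional (c%:MP * x) = c * top_functional x.
Proof. by rewrite mul_mpolyC linearZ. Qed.

Lemma odd_residue_small l (ln : (l < n)%N) :
  odd_residue l.*2.+1 = \row_j (j == l :> nat)%:R.
Proof.
elim: l ln => [|l IH] ln; first by rewrite double0.
have {}IH := IH (ltnW ln).
rewrite doubleS.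
rewrite (odd_residueSS l.*2.+1).
rewrite IH.
apply/rowP => j; rewrite !mxE (bigD1 (Ordinal (ltnW ln))) //= !mxE eqxx mul1r.
rewrite big1 ?addr0 => [|i il]; last first.
  rewrite !mxE; case: (nat_of_ord i =P l) il => [e /eqP[]|_ _]; [exact: val_inj|by rewrite mul0r].
by rewrite /= ltn_eqF; [rewrite eq_sym|lia].
Qed.

Lemma odd_residue_even l : odd_residue l.*2 = 0.
Proof.
elim: l => [|l IH]; first by rewrite double0.
by rewrite doubleS odd_residueSS IH mul0mx.
Qed.

Lemma top_functional_prod N (P : 'I_n -> nat -> R) :
  top_functional (\prod_i \sum_(k < N) P i k *: 'X_i ^+ k) =
  \det (\matrix_(i, j) \sum_(k < N) P i k * odd_residue k 0 j).
Proof.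
rewrite (det_row_sum (fun i (k : 'I_N) => P i k) (fun i (k : 'I_N) => odd_residue k)).
rewrite bigA_distr_bigA linear_sum; apply: eq_bigr => g _.
have -> : \prod_i (P i (g i) *: 'X_i ^+ g i) =
    (\prod_i P i (g i)) *: 'X_[[multinom (g i : nat) | i < n]] :> {mpoly R[n]}.
  rewrite scaler_prod mpolyXE_id; congr (_ *: _).
  by apply: eq_bigr => i _; rewrite mnmE.
rewrite linearZ /= top_functionalX; congr (_ * \det _).
by apply/matrixP => i j; rewrite !mxE mnmE.
Qed.

Hypothesis mon_p : p \is monic.
Hypothesis size_p : size p = n.+1.

Lemma char_poly_companion : char_poly companion = p.
Proof.
rewrite -[RHS](companionmxK mon_p) /companion /companionmx.
by have -> : (size p).-1 = n by rewrite size_p.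
Qed.

Lemma char_poly_comp_Xsqr (C : 'M[R]_n) :
  \det (\matrix_(i, j) ('X^2 * (C i j)%:P - ((C *m companion) i j)%:P)) =
  (p \Po 'X^2) * (\det C)%:P.
Proof.
have -> : p \Po 'X^2 = \det ('X^2%:M - map_mx polyC companion).
  rewrite -[in LHS]char_poly_companion /char_poly.
  rewrite -[LHS](det_map_mx (comp_poly 'X^2)); congr (\det _).
  apply/matrixP => i j; rewrite !mxE rmorphB /= comp_polyC rmorphMn /=.
  by rewrite comp_polyX.
rewrite -det_map_mx mulrC -det_mulmx; congr (\det _).
rewrite mulmxBr mul_mx_scalar -map_mxM; apply/matrixP => i j.
by rewrite !mxE.
Qed.

(** Multiplying a monomial by ['X_i ^+ 2] multiplies row [i] of its determinant by the companion
    matrix. The product of the ['X^2 - 'X_i ^+ 2] thus acts on every row as ['X^2 - companion], that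
    is, on the determinant as the scalar [p('X^2)]. *)
Lemma top_functional_relation (x : {mpoly R[n]}) k :
  top_functional (x * (map_poly (@mpolyC n R) (p \Po 'X^2) -
     \prod_(i < n) ('X^2 - ('X_i ^+ 2)%:P))`_k) = 0.
Proof.
rewrite [x]mpolyE mulr_suml linear_sum big1 // => m _.
rewrite -scalerAl linearZ /= coefB coef_map mulrBr linearB /=.
rewrite ['X_[m] * mpolyC _ _]mulrC top_functionalCM top_functionalX.
pose sg (b : bool) : R := if b then 1 else -1.
(* [g] records the factors from which the term ['X^2] is taken; [ex g] is then the degree in ['X]
   and [mg g] the exponent of the monomial. Both sides expand into the same sum over [g]. *)
pose ex (g : {ffun 'I_n -> bool}) := \sum_i (if g i then 2 else 0)%N.
pose mg (g : {ffun 'I_n -> bool}) := (m + [multinom (if g i then 0 else 2)%N | i < n])%MM.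
suff [e1 e2] : (p \Po 'X^2)`_k * top_monomial m =
      \sum_(g : {ffun 'I_n -> bool}) (k == ex g)%:R * (\prod_i sg (g i)) * top_monomial (mg g)
    /\ top_functional ('X_[m] * (\prod_(i < n) ('X^2 - ('X_i ^+ 2)%:P))`_k) =
      \sum_(g : {ffun 'I_n -> bool}) (k == ex g)%:R * (\prod_i sg (g i)) * top_monomial (mg g).
  by rewrite e1 e2 subrr mulr0.
split.
  rewrite -coefMC /top_monomial -char_poly_comp_Xsqr.
  have -> : (\matrix_(i, j) ('X^2 * ((\matrix_(i, j) odd_residue (m i) 0 j) i j)%:P -
       ((\matrix_(i, j) odd_residue (m i) 0 j *m companion) i j)%:P)) =
     \matrix_(i, j) \sum_(b : bool) (if b then 'X^2 else -1) *
        (map_mx polyC (odd_residue (m i + if b then 0 else 2))) 0 j :> 'M[{poly R}]_n.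
    apply/matrixP => i j; rewrite !mxE big_bool !mxE /= addn0 addn2 mulN1r.
    congr (_ - _%:P); rewrite mxE; apply: eq_bigr => l _; by rewrite !mxE.
  rewrite (det_row_sum (fun i (b : bool) => if b then 'X^2 else -1)
    (fun i (b : bool) => map_mx polyC (odd_residue (m i + if b then 0 else 2)))).
  rewrite coef_sum; apply: eq_bigr => g _.
  have -> : \prod_i (if g i then 'X^2 else -1) = 'X^(ex g) * (\prod_i sg (g i))%:P :> {poly R}.
    rewrite rmorph_prod -prodrXr -big_split; apply: eq_bigr => i _ /=.
    by case: (g i); rewrite ?expr0 ?mulr1 // mul1r rmorphN.
  rewrite -(mulrA 'X^(ex g)) coefXnM.
  have -> : \det (\matrix_(i, j) (map_mx polyC
      (odd_residue (m i + if g i then 0 else 2))) 0 j) = (top_monomial (mg g))%:P.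
    rewrite /top_monomial -det_map_mx; congr (\det _); apply/matrixP => i j.
    by rewrite !mxE mnmDE mnmE.
  rewrite -polyCM coefC -mulrA; case: ltngtP => [lt|gt|->]; rewrite ?mul0r //.
    by rewrite subn_eq0 leqNgt gt.
  by rewrite subnn mul1r.
have -> : \prod_(i < n) ('X^2 - ('X_i ^+ 2)%:P) =
    \prod_(i < n) \sum_(b : bool) (if b then 'X^2 else - ('X_i ^+ 2)%:P) :> {poly {mpoly R[n]}}.
  by apply: eq_bigr => i _; rewrite big_bool.
rewrite bigA_distr_bigA coef_sum mulr_sumr linear_sum; apply: eq_bigr => g _.
have -> : \prod_i (if g i then 'X^2 else - ('X_i ^+ 2)%:P) = 'X^(ex g) *
    ((\prod_i sg (g i)) *: 'X_[[multinom (if g i then 0 else 2)%N | i < n]])%:P :> {poly {mpoly R[n]}}.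
  rewrite -prodrXr mpolyXE_id -scaler_prod rmorph_prod -big_split; apply: eq_bigr => i _ /=.
  rewrite mnmE; case: (g i); rewrite /sg ?expr0 ?mulr1 ?mul1r ?scale1r //.
    by rewrite rmorph1 mulr1.
  by rewrite scaleN1r rmorphN.
rewrite coefXnM coefC; case: ltngtP => [lt|gt|->]; rewrite ?mulr0 ?linear0 ?mul0r //.
  by rewrite subn_eq0 leqNgt gt mulr0 linear0.
by rewrite subnn eqxx -scalerAr linearZ /= -mpolyXD top_functionalX mul1r.
Qed.

End TopFunctional.

Arguments odd_residue : simpl never.

Section BaseChange.
Variables (R S : comNzRingType) (phi : {rmorphism R -> S}) (n : nat) (p : {poly R}).

Lemma map_odd_residue k :
  map_mx phi (odd_residue n p k) = odd_residue n (map_poly phi p) k.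
Proof.
have mapC : map_mx phi (companion n p) = companion n (map_poly phi p).
  apply/matrixP => i j; rewrite !mxE coef_map.
  by case: eqP => _; rewrite ?rmorphN ?rmorph_nat.
suff : map_mx phi (odd_residue n p k) = odd_residue n (map_poly phi p) k /\
    map_mx phi (odd_residue n p k.+1) = odd_residue n (map_poly phi p) k.+1 by case.
elim: k => [|k [IH1 IH2]].
  split; first by rewrite map_mx0.
  by apply/rowP => j; rewrite !mxE rmorph_nat.
by split=> //; rewrite !odd_residueSS map_mxM IH1 mapC.
Qed.

Lemma map_top_functional (x : {mpoly R[n]}) :
  top_functional (map_poly phi p) (map_mpoly phi x) = phi (top_functional p x) :> S.
Proof.
elim/mpolyind: x => [|c m x _ _ IH]; first by rewrite !raddf0.
rewrite rmorphD linearD /= IH linearD rmorphD; congr (_ + _).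
rewrite map_mpolyZ map_mpolyX !linearZ rmorphM /= !top_functionalX; congr (_ * _).
rewrite /top_monomial -det_map_mx; congr (\det _); apply/matrixP => i j.
by rewrite !mxE -map_odd_residue mxE.
Qed.

End BaseChange.

Lemma size_prod_monic (R : nzRingType) (I : finType) (P : pred I)
    (F : I -> {poly R}) d :
  (forall i, F i \is monic /\ size (F i) = d.+1) ->
  size (\prod_(i | P i) F i) = (d * \sum_(i | P i) 1).+1.
Proof.
move=> hF; suff [_ ->] : \prod_(i | P i) F i \is monic /\
  size (\prod_(i | P i) F i) = (d * \sum_(i | P i) 1).+1 by [].
elim/big_rec2: _ => [|i k q _ [mq sq]]; first by rewrite monic1 size_poly1 muln0.
have [mF sF] := hF i; split; first exact: rpredM.
by rewrite size_monicM ?monic_neq0 // sF sq addSn /= mulnDr muln1 addnS.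
Qed.

(** * Interpolation at a factorization of [p(u^2)] *)

Section Interpolation.
Variables (S : comNzRingType) (n : nat) (p : {poly S}).
Hypothesis mon_p : p \is monic.
Hypothesis size_p : size p = n.+1.

(** Evaluation at [x] turns the companion matrix into multiplication by [x ^+ 2]. *)
Lemma odd_residue_eval (x : S) k : (0 < n)%N -> p.[x ^+ 2] = 0 ->
  \sum_(r < n) odd_residue n p k 0 r * x ^+ r.*2.+1 = if odd k then x ^+ k else 0.
Proof.
move=> n_gt0 px.
pose ev (c : 'rV[S]_n) := \sum_(r < n) c 0 r * x ^+ r.*2.+1.
have px2 : x ^+ n.*2 = - \sum_(j < n) p`_j * x ^+ j.*2.
  apply: (addIr (\sum_(j < n) p`_j * x ^+ j.*2)); rewrite addNr; apply: etrans px.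
  rewrite horner_coef size_p big_ord_recr /= addrC; congr (_ + _).
    by have /eqP := mon_p; rewrite /lead_coef size_p => ->; rewrite mul1r -exprM mul2n.
  by apply: eq_bigr => j _; rewrite -exprM mul2n.
have evM c : ev (c *m companion n p) = x ^+ 2 * ev c.
  rewrite /ev; under eq_bigr do rewrite mxE mulr_suml.
  rewrite exchange_big mulr_sumr; apply: eq_bigr => i _ /=.
  under eq_bigr do rewrite -mulrA.
  rewrite -mulr_sumr mulrCA; congr (_ * _); rewrite -exprD.
  have [e|ne] := eqVneq (nat_of_ord i) n.-1.
    transitivity (- (\sum_(j < n) p`_j * x ^+ j.*2) * x).
      rewrite -sumrN mulr_suml; apply: eq_bigr => j _.
      by rewrite mxE e eqxx exprSr; ring.
    by rewrite -px2 -exprSr e; congr (_ ^+ _); lia.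
  have i1n : (i.+1 < n)%N by have := ltn_ord i; lia.
  rewrite (bigD1 (Ordinal i1n)) //= mxE (negPf ne) eqxx mul1r big1 ?addr0.
    by congr (_ ^+ _); lia.
  move=> j ji; rewrite mxE (negPf ne).
  case: (i.+1 =P j :> nat) ji => [e /eqP[]|_ _]; [exact: val_inj|by rewrite mul0r].
rewrite -/(ev _).
suff : ev (odd_residue n p k) = (if odd k then x ^+ k else 0) /\
    ev (odd_residue n p k.+1) = (if odd k.+1 then x ^+ k.+1 else 0) by case.
elim: k => [|k [IH1 IH2]].
  split; first by rewrite /ev big1 // => r _; rewrite mxE mul0r.
  rewrite /ev (bigD1 (Ordinal n_gt0)) //= mxE /= mul1r big1 ?addr0 // => r r0.
  rewrite mxE; case: (r =P 0 :> nat) r0 => [e /eqP[]|_ _]; [exact: val_inj|by rewrite mul0r].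
split=> //; rewrite odd_residueSS evM IH1 [odd k.+2]/= negbK.
by case: ifP => _; rewrite ?mulr0 // -exprD.
Qed.

(** When [z] splits [p(u^2)], multiplication by this element identifies each ['X_k] with [z k] in
    the quotient, so pairing with it evaluates at [z]. *)
Definition reproducing_kernel (z : 'I_n -> S) : {mpoly S[n]} :=
  \prod_(j < n) (('X_j + (z j)%:MP) * \prod_(i < n | (i < j)%N) ('X_j ^+ 2 - (z i ^+ 2)%:MP)).

(** Factor [j] is a monic polynomial of degree [2j+1] in ['X_j], and its odd powers are already
    reduced, so the determinant is that of a unitriangular matrix. *)
Lemma top_functional_kernel z : top_functional p (reproducing_kernel z) = 1.
Proof.
pose P (j : 'I_n) : {poly S} :=
  ('X + (z j)%:P) * \prod_(i < n | (i < j)%N) ('X^2 - (z i ^+ 2)%:P).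
have X2m (c : S) : ('X^2 - c%:P) \is monic /\ size ('X^2 - c%:P) = 3%N.
  by rewrite monicXnsubC // size_XnsubC.
have Pm j : P j \is monic.
  rewrite rpredM ?monicXaddC //; apply: monic_prod => i _; exact: (proj1 (X2m _)).
have sP j : size (P j) = j.*2.+2.
  rewrite size_monicM ?monicXaddC ?monic_neq0 ?monic_prod //; last first.
    by move=> i _; apply: (proj1 (X2m _)).
  rewrite size_XaddC (@size_prod_monic _ _ _ _ 2) //.
  by rewrite -(big_ord_widen n (fun=> 1%N) (ltnW (ltn_ord j))) sum1_card card_ord mul2n.
have -> : reproducing_kernel z = \prod_j \sum_(k < n.*2) (P j)`_k *: 'X_j ^+ k.
  apply: eq_bigr => j _.
  transitivity ((map_poly (@mpolyC n S) (P j)).['X_j]).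
    rewrite /P rmorphM rmorphD /= map_polyX map_polyC rmorph_prod hornerM !hornerE.
    rewrite horner_prod; congr (_ * _); apply: eq_bigr => i _.
    by rewrite rmorphB /= map_polyXn map_polyC hornerD hornerN hornerXn hornerC.
  rewrite (@horner_coef_wide _ n.*2); last first.
    by apply: leq_trans (size_poly _ _) _; rewrite sP; have := ltn_ord j; lia.
  by apply: eq_bigr => k _; rewrite coef_map mul_mpolyC.
rewrite (top_functional_prod p n.*2 (fun j k => (P j)`_k)).
have entry j (l : 'I_n) : \sum_(k < n.*2) (P j)`_k * odd_residue n p k 0 l = (P j)`_(l.*2.+1).
  have ln : (l.*2.+1 < n.*2)%N by have := ltn_ord l; lia.
  rewrite (bigD1 (Ordinal ln)) //= odd_residue_small // mxE eqxx mulr1 big1 ?addr0 // => k kl.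
  case: (boolP (odd k)) => ok; last first.
    by rewrite -(even_halfK ok) odd_residue_even mxE mulr0.
  have kE : nat_of_ord k = k./2.*2.+1 by rewrite odd_halfK // prednK // odd_gt0.
  rewrite [in odd_residue _ _ _]kE odd_residue_small; last by have := ltn_ord k; lia.
  rewrite mxE; case: (l =P k./2 :> nat) kl => [e /eqP[]|]; last by rewrite mulr0.
  by apply: val_inj; rewrite /= e -kE.
rewrite det_trig.
  rewrite big1 // => j _; rewrite mxE entry.
  by have /eqP := Pm j; rewrite /lead_coef sP.
apply/is_trig_mxP => j l jl; rewrite mxE entry nth_default // sP.
by rewrite !ltnS ltn_double.
Qed.

End Interpolation.

Lemma monic_mulC_inj (R : comNzRingType) (p q r : {poly R}) (c : R) :
  p \is monic -> c%:P * (p * q) = c%:P * (p * r) -> c%:P * q = c%:P * r.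
Proof.
move=> mp e; have /monic_lreg := mp.
by apply; rewrite mulrCA e mulrCA.
Qed.

(* Interpolation: multiplying by the factors of the kernel one at a time
   identifies [x k] with [z k] and then the remaining factors of the two
   factorizations. *)
Lemma kernel_identifies (R : comNzRingType) n (x z : 'I_n -> R) :
  \prod_(i < n) ('X^2 - (x i ^+ 2)%:P) = \prod_(i < n) ('X^2 - (z i ^+ 2)%:P) ->
  let K := \prod_(j < n) ((x j + z j) * \prod_(i < n | (i < j)%N) (x j ^+ 2 - z i ^+ 2)) in
  forall k, x k * K = z k * K.
Proof.
move=> exz K.
(* [th k] collects the factors of [K] that contain [z k]; the product over [j == k] lets [k] range
   over [nat]. *)
pose th (k : nat) := \prod_(j < n | j == k :> nat)
  ((x j + z j) * \prod_(l < n | (k < l)%N) (x l ^+ 2 - z j ^+ 2)).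
pose Th k := \prod_(0 <= i < k) th i.
pose F (y : 'I_n -> R) k : {poly R} := \prod_(j < n | (k <= j)%N) ('X^2 - (y j ^+ 2)%:P).
have FS y (k : 'I_n) : F y k = ('X^2 - (y k ^+ 2)%:P) * F y k.+1.
  rewrite /F (bigD1 k) //=; congr (_ * _); apply: eq_bigl => j.
  by rewrite -val_eqE /= andbC eq_sym ltn_neqAle.
have thE (k : 'I_n) : th k = (x k + z k) * \prod_(l < n | (k < l)%N) (x l ^+ 2 - z k ^+ 2).
  by rewrite /th (big_pred1 k).
have main k : (k <= n)%N -> (Th k)%:P * F x k = (Th k)%:P * F z k /\
    forall j : 'I_n, (j < k)%N -> x j * Th k = z j * Th k.
  elim: k => [|k IH] kn; first by split=> //; rewrite /F exz.
  have [eF ex] := IH (ltnW kn); pose o := Ordinal kn.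
  have ThS : Th k.+1 = Th k * th o by rewrite /Th big_nat_recr.
  have ek : x o * Th k.+1 = z o * Th k.+1.
    apply/eqP; rewrite -subr_eq0 -mulrBl ThS thE; apply/eqP.
    have : Th k * (F x k).[z o] = 0.
      have := congr1 (horner ^~ (z o)) eF; rewrite !hornerM !hornerC => ->.
      rewrite (FS z o) hornerM hornerD hornerN hornerXn hornerC.
      by rewrite subrr mul0r mulr0.
    rewrite (FS x o) /F hornerM horner_prod hornerD hornerN hornerXn hornerC => e0.
    have -> : \prod_(l < n | (k < l)%N) (x l ^+ 2 - z o ^+ 2) =
        (-1) ^+ #|[pred l : 'I_n | (k < l)%N]| *
        \prod_(l < n | (k < l)%N) ('X^2 - (x l ^+ 2)%:P).[z o].
      rewrite -prodrN; apply: eq_bigr => l _.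
      by rewrite hornerD hornerN hornerXn hornerC opprB.
    set s := (-1) ^+ _; set q := \prod_(l < n | _) _ in e0 *.
    transitivity (- s * (Th k * ((z o ^+ 2 - x o ^+ 2) * q))); first by ring.
    by rewrite e0 mulr0.
  split; last first.
    move=> j; rewrite ltnS leq_eqVlt => /predU1P[jk|/ex e]; last by rewrite ThS !mulrA e.
    by have -> : j = o by apply: val_inj.
  apply: (@monic_mulC_inj _ ('X^2 - (z o ^+ 2)%:P)); first by rewrite monicXnsubC.
  rewrite -(FS z o).
  transitivity ((Th k.+1)%:P * F x k).
    rewrite (FS x o) !mulrA; congr (_ * _).
    rewrite !mulrBr -!polyCM; congr (_ - _%:P).
    by rewrite mulrC expr2 -mulrA -ek mulrCA -ek; ring.
  by rewrite ThS polyCM -mulrA mulrCA [in RHS]mulrAC -!mulrA eF; ring.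
have ThK : Th n = K.
  rewrite /Th big_mkord /K; under [RHS]eq_bigr do rewrite big_mkcond.
  rewrite [RHS]big_split [X in _ = _ * X]exchange_big -big_split /=.
  by apply: eq_bigr => i _; rewrite thE [in LHS]big_mkcond.
by move=> k; rewrite -ThK; apply: (proj2 (main n (leqnn n))).
Qed.

(** * Resultants and discriminants *)

(* Both blocks of the Sylvester matrix are rewritten in the Newton basis
   [prod_(j < k) ('X - x j)], completed by the multiples ['X^j * p]. *)
Section ResultantRoots.
Variables (R : comNzRingType) (x : nat -> R) (q : {poly R}).

Let newton k : {poly R} := \prod_(j < k) ('X - (x j)%:P).

Let newtonS k : newton k.+1 = newton k * ('X - (x k)%:P).
Proof. by rewrite /newton big_ord_recr. Qed.

Let newton_monic k : newton k \is monic.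
Proof. by apply: monic_prod => j _; apply: monicXsubC. Qed.

Let size_newton k : size (newton k) = k.+1.
Proof.
rewrite /newton (@size_prod_monic _ _ _ _ 1).
  by rewrite sum1_card card_ord mul1n.
by move=> i; rewrite monicXsubC size_XsubC.
Qed.

Let newton_expand d m (r : {poly R}) : exists (a : nat -> R) (g : {poly R}),
  [/\ newton d * r = \sum_(d <= k < d + m) a k *: newton k + newton (d + m) * g &
      (0 < m)%N -> a d = r.[x d]].
Proof.
elim: m d r => [|m IH] d r.
  by exists (fun=> 0), r; rewrite addn0 big_geq // add0r.
have /factor_theorem[r1 er] : root (r - r.[x d]%:P) (x d).
  by rewrite rootE hornerD hornerN hornerC subrr.
have [a [g [e _]]] := IH d.+1 r1.
exists (fun k => if k == d then r.[x d] else a k), g; rewrite eqxx; split=> //.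
rewrite -[r in LHS](subrK r.[x d]%:P) er mulrDr [r1 * _]mulrC mulrA -newtonS e.
rewrite -addSnnS addrAC; congr (_ + _).
rewrite [RHS]big_ltn ?ltnS ?leq_addr // eqxx addrC mulrC mul_polyC; congr (_ + _).
apply: eq_big_nat => k /andP[dk _].
by rewrite gtn_eqF.
Qed.

Lemma resultant_roots d (p : {poly R}) : (size p).-1 = d ->
  p = \prod_(i < d) ('X - (x i)%:P) -> resultant q p = \prod_(i < d) q.[x i].
Proof.
move=> <-; rewrite -/(newton _) => pE.
rewrite /resultant /Sylvester_mx.
set d1 := (size p).-1 in pE *; set e := (size q).-1.
have /fin_all_exists[a /fin_all_exists[g ag]] : forall i : 'I_d1,
    exists (a : nat -> R) (g : {poly R}),
    [/\ newton i * q = \sum_(i <= k < d1) a k *: newton k + newton d1 * g &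
        a i = q.[x i]].
  move=> i; have [a [g [eq ai]]] := newton_expand i (d1 - i) q.
  rewrite subnKC ?(ltnW (ltn_ord i)) // in eq; exists a, g; split=> //.
  by apply: ai; rewrite subn_gt0.
have sg i : (size (g i) <= e)%N.
  have [eq _] := ag i.
  have [->|g0] := eqVneq (g i) 0; first by rewrite size_poly0.
  have : (size (newton d1 * g i)%R <= d1 + e)%N.
    have -> : newton d1 * g i = newton i * q - \sum_(i <= k < d1) a i k *: newton k.
      by rewrite eq addrC addKr.
    have := ltn_ord i; rewrite -/d1 => id1.
    apply: leq_trans (size_polyD _ _) _; rewrite geq_max size_polyN; apply/andP; split.
      apply: leq_trans (size_polyMleq _ _) _; rewrite size_newton addSn /= /e.
      by move: (size q) => s; lia.
    apply/leq_sizeP => l dl; rewrite coef_sum big_nat big1 // => k /andP[_ kd].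
    by rewrite coefZ nth_default ?mulr0 // size_newton; lia.
  by rewrite size_monicM // size_newton addSn /= leq_add2l.
pose U : 'M[R]_d1 := \matrix_i poly_rV (newton i).
pose W : 'M[R]_(d1, d1 + e) := \matrix_i poly_rV (newton i).
pose A : 'M[R]_d1 := \matrix_(i, k) if (i <= k)%N then a i k else 0.
pose G : 'M[R]_(d1, e) := \matrix_i poly_rV (g i).
set Bq := lin1_mx _; set Bp := lin1_mx _.
have UA : U *m Bq = A *m W + G *m Bp.
  apply/row_matrixP => i; rewrite linearD /= !row_mul !rowK !mul_rV_lin1 /=.
  rewrite !poly_rV_K ?size_newton //.
  have [-> _] := ag i; rewrite linearD /= -pE mulrC; congr (_ + poly_rV _).
  rewrite mulmx_sum_row linear_sum (big_nat_widenl _ 0) //= big_mkord big_mkcond /=.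
  apply: eq_bigr => k _; rewrite rowK !mxE ?andbT; case: ifP => _; last by rewrite scale0r.
  by rewrite linearZ.
have detU : \det U = 1.
  rewrite det_trig; last first.
    apply/is_trig_mxP => i j ij; rewrite !mxE nth_default // size_newton.
    exact: ij.
  rewrite big1 // => i _; rewrite !mxE; have /eqP := newton_monic i.
  by rewrite /lead_coef size_newton.
have detW : \det (col_mx W Bp) = 1.
  pose w (k : 'I_(d1 + e)) : {poly R} := if (k < d1)%N then newton k else 'X^(k - d1) * p.
  have wE k l : col_mx W Bp k l = (w k)`_l.
    rewrite mxE /w; case: splitP => i ki; first by rewrite !mxE ki.
    by rewrite ki addKn !mxE /= rVpoly_delta.
  have sw k : w k \is monic /\ size (w k) = k.+1.
    rewrite /w; case: ltnP => kd; first by split; [exact: newton_monic|exact: size_newton].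
    rewrite pE; split; first by rewrite rpredM ?monicXn //; apply: newton_monic.
    by rewrite size_monicM ?monicXn ?monic_neq0 // size_polyXn size_newton addSn /= addnS subnK.
  rewrite det_trig; last first.
    by apply/is_trig_mxP => i j ij; rewrite wE nth_default // (proj2 (sw i)).
  rewrite big1 // => i _; rewrite wE; have [/eqP + si] := sw i.
  by rewrite /lead_coef si.
have detA : \det A = \prod_(i < d1) q.[x i].
  rewrite -det_tr det_trig; last first.
    by apply/is_trig_mxP => i j ij; rewrite !mxE leqNgt ij.
  by apply: eq_bigr => i _; rewrite !mxE leqnn; case: (ag i).
(* [U] and the stack of [W] and [Bp] are unitriangular, and [A] is triangular with diagonal
   [q.[x i]]; determinants give the claim. *)
have : block_mx U 0 0 1%:M *m col_mx Bq Bp = block_mx A G 0 1%:M *m col_mx W Bp.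
  by rewrite !mul_block_col !mul0mx !mul1mx addr0 !add0r UA.
move=> /(congr1 determinant); rewrite !det_mulmx !det_ublock.
by rewrite detU detW detA !det1 !mulr1 mul1r.
Qed.

End ResultantRoots.

Section DiscriminantRoots.
Variables (R : comNzRingType) (n : nat) (x : 'I_n -> R).

Let p : {poly R} := \prod_(i < n) ('X - (x i)%:P).

Lemma resultant_ord_roots (q : {poly R}) : resultant q p = \prod_(i < n) q.[x i].
Proof.
pose y k := oapp x 0 (insub k : option 'I_n).
have yE (i : 'I_n) : y i = x i by rewrite /y valK.
have -> : \prod_(i < n) q.[x i] = \prod_(i < n) q.[y i].
  by apply: eq_bigr => i _; rewrite yE.
apply: resultant_roots; last by apply: eq_bigr => i _; rewrite yE.
rewrite /p (@size_prod_monic _ _ _ _ 1) ?sum1_card ?card_ord ?mul1n //.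
by move=> i; rewrite monicXsubC size_XsubC.
Qed.

Lemma disc_monic_roots :
  disc_monic p = (\prod_(i < n) \prod_(j < n | (i < j)%N) (x j - x i)) ^+ 2.
Proof.
have sp : (size p).-1 = n.
  rewrite /p (@size_prod_monic _ _ _ _ 1) ?sum1_card ?card_ord ?mul1n //.
  by move=> i; rewrite monicXsubC size_XsubC.
have dp i : p^`().[x i] = \prod_(j < n | j != i) (x i - x j).
  rewrite /p (bigD1 i) //= derivM hornerD !hornerM derivXsubC !hornerE subrr.
  rewrite mul0r addr0 horner_prod; apply: eq_bigr => j _.
  by rewrite !hornerE.
rewrite /disc_monic sp resultant_ord_roots.
have -> : \prod_(i < n) p^`().[x i] =
  \prod_(i < n) \prod_(j < n | (i < j)%N) (x i - x j) *
  \prod_(i < n) \prod_(j < n | (i < j)%N) (x j - x i).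
  rewrite [X in _ = _ * X](exchange_big_dep predT) //= -big_split.
  apply: eq_bigr => i _; rewrite dp (bigID (fun j : 'I_n => (i < j)%N)) /=.
  congr (_ * _); apply: eq_bigl => j; rewrite -val_eqE /=; lia.
have -> : \prod_(i < n) \prod_(j < n | (i < j)%N) (x i - x j) =
  (-1) ^+ 'C(n, 2) * \prod_(i < n) \prod_(j < n | (i < j)%N) (x j - x i).
  transitivity (\prod_(i < n) \prod_(j < n | (i < j)%N) (-1 * (x j - x i))).
    by apply: eq_bigr => i _; apply: eq_bigr => j _; rewrite mulN1r opprB.
  under eq_bigr do rewrite big_split; rewrite big_split; congr (_ * _).
  rewrite (exchange_big_dep predT) //= -bin2_sum big_mkord -prodrXr.
  apply: eq_bigr => j _.
  rewrite prodr_const; congr (_ ^+ _).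
  by rewrite -sum1_card -(big_ord_widen n (fun=> 1%N) (ltnW (ltn_ord j))) sum1_card card_ord.
by rewrite mulrA signrMK.
Qed.

End DiscriminantRoots.

(** * Signed permutations and the final argument *)

Section QuotientMap.
Variables (R : comPzRingType) (I : ideal R).

Definition qproj (x : R) : quotring I := \pi_(quotring I) x.

Fact qproj_zmod_morphism : zmod_morphism qproj.
Proof.
have qD x y : qproj (x + y) = qproj x + qproj y.
  by rewrite -[RHS]/(Quotient.add _ _) /qproj -Quotient.pi_add.
by move=> x y; apply: (addIr (qproj y)); rewrite -qD !subrK.
Qed.
Fact qproj_monoid_morphism : monoid_morphism qproj.
Proof. by split=> // x y; apply: quotring_piM. Qed.
HB.instance Definition _ :=
  GRing.isZmodMorphism.Build R (quotring I) qproj qproj_zmod_morphism.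
HB.instance Definition _ :=
  GRing.isMonoidMorphism.Build R (quotring I) qproj qproj_monoid_morphism.

Lemma qproj_eq0 x : qproj x = 0 <-> ideal_set I x.
Proof. by rewrite -(rmorph0 qproj) quotring_eqP subr0. Qed.

Lemma qproj_surj y : exists x, qproj x = y.
Proof. by have [x ->] := quotringP y; exists x. Qed.

End QuotientMap.

Lemma idealgen_kernel (R : comPzRingType) (V : nmodType) (F : {additive R -> V}) (G : set R) :
  (forall x g, G g -> F (x * g) = 0) -> forall x, idealgen_set G x -> F x = 0.
Proof.
move=> FG _ [m [c [g [Gg ->]]]]; rewrite raddf_sum big1 // => i _; exact: FG.
Qed.

Section SplitFunctional.
Variables (S : comNzRingType) (n : nat) (p : {poly S}).
Hypothesis mon_p : p \is monic.
Hypothesis size_p : size p = n.+1.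

Lemma top_functional_ideal (x : {mpoly S[n]}) :
  ideal_set (ssplit_ideal n (p \Po 'X^2)) x -> top_functional p x = 0.
Proof.
apply: (@idealgen_kernel _ _ (top_functional p)) => y _ [k _ <-].
exact: top_functional_relation.
Qed.

(** The functional kills the ideal but is 1 on the kernel at any point, here the origin. *)
Lemma ssplit_ideal_proper : ~ ideal_set (ssplit_ideal n (p \Po 'X^2)) 1.
Proof.
have [_ _ IM] := idealP (ssplit_ideal n (p \Po 'X^2)).
move=> /(IM (reproducing_kernel (fun _ : 'I_n => 0))); rewrite mulr1.
move/top_functional_ideal; rewrite top_functional_kernel //.
by move/eqP; rewrite oner_eq0.
Qed.

Lemma SSplit_nonzero : 1 != 0 :> SSplit n (p \Po 'X^2).
Proof.
apply/eqP; rewrite -(rmorph1 (qproj _)) => /qproj_eq0.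
exact: ssplit_ideal_proper.
Qed.

Lemma ssplit_factor (B : comNzRingType) (q : {rmorphism {mpoly S[n]} -> B}) :
  (forall x, ideal_set (ssplit_ideal n (p \Po 'X^2)) x -> q x = 0) ->
  map_poly (q \o @mpolyC n S) (p \Po 'X^2) =
  \prod_(i < n) ('X^2 - (q 'X_i ^+ 2)%:P).
Proof.
move=> qI.
have : map_poly q (map_poly (@mpolyC n S) (p \Po 'X^2) -
    \prod_(i < n) ('X^2 - ('X_i ^+ 2)%:P)) = 0.
  apply/polyP => k; rewrite coef_map coef0; apply: qI.
  exists 1%N, (fun=> 1), (fun=> (map_poly (@mpolyC n S) (p \Po 'X^2) -
    \prod_(i < n) ('X^2 - ('X_i ^+ 2)%:P))`_k).
  by split=> [_|]; [exists k|rewrite big_ord1 mul1r].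
rewrite rmorphB /= -map_poly_comp => /subr0_eq ->.
rewrite rmorph_prod; apply: eq_bigr => i _.
by rewrite rmorphB /= map_polyXn map_polyC /= (rmorphXn q).
Qed.

Lemma kernel_eval (z : 'I_n -> S) (E : comNzRingType) (q : {rmorphism {mpoly S[n]} -> E}) :
  (forall x, ideal_set (ssplit_ideal n (p \Po 'X^2)) x -> q x = 0) ->
  p \Po 'X^2 = \prod_(i < n) ('X^2 - (z i ^+ 2)%:P) ->
  forall x, q (x * reproducing_kernel z) = q ((x.@[z])%:MP * reproducing_kernel z).
Proof.
move=> qI pz x; set K := reproducing_kernel z.
pose u i := q 'X_i; pose v i := q (z i)%:MP.
have qK : q K = \prod_(j < n) ((u j + v j) * \prod_(i < n | (i < j)%N) (u j ^+ 2 - v i ^+ 2)).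
  rewrite rmorph_prod; apply: eq_bigr => j _; rewrite rmorphM rmorphD rmorph_prod /=.
  congr (_ * _); apply: eq_bigr => i _.
  by rewrite rmorphB /= !(rmorphXn, rmorphXn q).
have uv : \prod_(i < n) ('X^2 - (u i ^+ 2)%:P) = \prod_(i < n) ('X^2 - (v i ^+ 2)%:P).
  rewrite -(ssplit_factor qI) pz rmorph_prod /=; apply: eq_bigr => i _.
  by rewrite rmorphB /= map_polyXn map_polyC /= !(rmorphXn, rmorphXn q).
have key i : u i * q K = v i * q K by rewrite qK; apply: (kernel_identifies uv).
rewrite !(rmorphM q) -/K; move: (q K) key => k key {qK}.
elim/mpolyind: x => [|c m y _ _ IH]; first by rewrite meval0 !rmorph0.
rewrite mevalD mevalZ mevalX !rmorphD /= !mulrDl IH; congr (_ + _).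
rewrite -mul_mpolyC !rmorphM /= -!mulrA; congr (_ * _).
rewrite mpolyXE_id !rmorph_prod /=.
apply: (big_ind2 (fun a b : E => a * k = b * k)) => //.
  by move=> a b c' d ab cd; rewrite -mulrA cd mulrCA ab mulrCA mulrA.
move=> i _; rewrite !rmorphXn /=; elim: (m i) => [|l IHl]; first by rewrite !expr0.
by rewrite !exprS -!mulrA IHl mulrCA key mulrCA.
Qed.

(** Modulo the ideal, [x] times the kernel is [x.@[z]] times the kernel, on which the functional is
    1. *)
Lemma reproducing_kernelP (z : 'I_n -> S) :
  p \Po 'X^2 = \prod_(i < n) ('X^2 - (z i ^+ 2)%:P) ->
  forall x, top_functional p (x * reproducing_kernel z) = x.@[z].
Proof.
move=> pz x; pose I := ssplit_ideal n (p \Po 'X^2).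
pose E : comNzRingType := HB.pack (quotring I)
  (GRing.PzSemiRing_isNonZero.Build (quotring I) SSplit_nonzero).
pose q : {rmorphism {mpoly S[n]} -> E} := qproj I.
have qI y : ideal_set I y -> q y = 0 by move=> /qproj_eq0.
have : qproj I (x * reproducing_kernel z - (x.@[z])%:MP * reproducing_kernel z) = 0.
  by rewrite rmorphB; apply/eqP; rewrite subr_eq0; apply/eqP; apply: (kernel_eval qI pz).
move=> /qproj_eq0/top_functional_ideal/eqP; rewrite linearB /= subr_eq0 => /eqP ->.
by rewrite top_functionalCM top_functional_kernel // mulr1.
Qed.

End SplitFunctional.

Lemma quotient_endomorphism (M B : comPzRingType) (q : {rmorphism M -> B})
    (phi : {rmorphism M -> M}) :
  (forall b, exists x, q x = b) -> (forall x, q x = 0 -> q (phi x) = 0) ->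
  exists psi : {rmorphism B -> B}, forall x, psi (q x) = q (phi x).
Proof.
move=> /choice[s sK] q0; pose psi b := q (phi (s b)).
have psiE x : psi (q x) = q (phi x).
  apply/eqP; rewrite -subr_eq0 -!rmorphB; apply/eqP/q0.
  by rewrite rmorphB sK subrr.
have psiB : zmod_morphism psi.
  by move=> a b; rewrite -[a]sK -[b]sK -rmorphB !psiE !rmorphB.
have psiM : monoid_morphism psi.
  split; first by rewrite -(rmorph1 q) psiE !rmorph1.
  by move=> a b; rewrite -[a]sK -[b]sK -rmorphM !psiE !rmorphM.
pose psi' : {rmorphism B -> B} := HB.pack psi
  (GRing.isZmodMorphism.Build B B psi psiB)
  (GRing.isMonoidMorphism.Build B B psi psiM).
by exists psi'.
Qed.

Section Splitting.
Variables (A : comNzRingType) (n : nat) (p : {poly A}) (B : comNzRingType).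
Variable q : {rmorphism {mpoly A[n]} -> B}.
Hypothesis n_gt0 : (0 < n)%N.
Hypothesis mon_p : p \is monic.
Hypothesis size_p : size p = n.+1.
Hypothesis q_surj : forall b, exists x, q x = b.
Hypothesis q_eq0 : forall x, q x = 0 <-> ideal_set (ssplit_ideal n (p \Po 'X^2)) x.

Let i : {rmorphism A -> B} := q \o @mpolyC n A.
Let eta k := q 'X_k.

Let factor : map_poly i p \Po 'X^2 = \prod_(k < n) ('X^2 - (eta k ^+ 2)%:P).
Proof.
rewrite -(@ssplit_factor A n p B q); last by move=> x /q_eq0.
by rewrite map_comp_poly map_polyXn.
Qed.

Let size_ip : size (map_poly i p) = n.+1.
Proof. by rewrite size_map_poly_id0 // (eqP mon_p) rmorph1 oner_neq0. Qed.

Lemma meval_map_split x : (map_mpoly i x).@[eta] = q x.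
Proof.
elim/mpolyind: x => [|c m x _ _ IH]; first by rewrite !raddf0.
rewrite !rmorphD /= IH; congr (_ + _).
rewrite map_mpolyZ map_mpolyX mevalZ mevalX -mul_mpolyC rmorphM /=; congr (_ * _).
by rewrite mpolyXE_id rmorph_prod; apply: eq_bigr => k _; rewrite rmorphXn.
Qed.

Lemma split_functional : exists T : B -> A, forall x, T (q x) = top_functional p x.
Proof.
have [s sK] := choice q_surj; exists (fun b => top_functional p (s b)) => x.
apply/eqP; rewrite -subr_eq0 -linearB; apply/eqP.
apply: (top_functional_ideal mon_p size_p); apply/q_eq0.
by rewrite rmorphB sK subrr.
Qed.

(** Over [B] the tuple [eta] splits [p(u^2)], and evaluating at [eta] gives back the class of [x].
    Expanding the kernel at [eta] in monomials yields its coefficients as [b] and the monomial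
    classes as [b']. *)
Lemma split_dual_basis (T : B -> A) : (forall x, T (q x) = top_functional p x) ->
  exists (I : finType) (b b' : I -> B), forall y, y = \sum_k i (T (y * b' k)) * b k.
Proof.
move=> TE; pose K := reproducing_kernel eta.
exists 'I_(size (msupp K)), (fun k => K@_(tnth (in_tuple (msupp K)) k)),
  (fun k => q 'X_[tnth (in_tuple (msupp K)) k]).
move=> y; have [x <-] := q_surj y.
rewrite -[LHS]meval_map_split.
rewrite -(reproducing_kernelP (monic_map i mon_p) size_ip factor) -/K.
rewrite {1}[K]mpolyE mulr_sumr linear_sum big_tnth; apply: eq_bigr => k _ /=.
rewrite -scalerAr linearZ /= [LHS]mulrC; congr (_ * _).
transitivity (i (top_functional p (x * 'X_[tnth (in_tuple (msupp K)) k]))).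
  by rewrite -(map_top_functional i) rmorphM /= map_mpolyX.
by rewrite -TE rmorphM.
Qed.

Let signed := ({ffun 'I_n -> bool} * 'S_n)%type.

Let signed_act (g : signed) : {rmorphism {mpoly A[n]} -> {mpoly A[n]}} :=
  comp_mpoly [tuple (-1) ^+ g.1 k *: 'X_(g.2 k) | k < n].

(** Squares forget the signs and the product over all variables is symmetric, so each generator of
    the ideal is fixed. *)
Lemma signed_act_ideal g x : q x = 0 -> q (signed_act g x) = 0.
Proof.
move=> /q_eq0 Ix; apply/q_eq0; move: x Ix.
have [I0 ID IM] := idealP (ssplit_ideal n (p \Po 'X^2)).
have inI k : ideal_set (ssplit_ideal n (p \Po 'X^2)) ((map_poly (@mpolyC n A) (p \Po 'X^2) -
    \prod_(i < n) ('X^2 - ('X_i ^+ 2)%:P))`_k).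
  exists 1%N, (fun=> 1), (fun=> (map_poly (@mpolyC n A) (p \Po 'X^2) -
    \prod_(i < n) ('X^2 - ('X_i ^+ 2)%:P))`_k).
  by split=> [_|]; [exists k|rewrite big_ord1 mul1r].
have gen : map_poly (signed_act g) (map_poly (@mpolyC n A) (p \Po 'X^2) -
    \prod_(i < n) ('X^2 - ('X_i ^+ 2)%:P)) = map_poly (@mpolyC n A) (p \Po 'X^2) -
    \prod_(i < n) ('X^2 - ('X_i ^+ 2)%:P).
  rewrite rmorphB /= -map_poly_comp; congr (_ - _).
    by apply: eq_map_poly => c /=; rewrite /signed_act comp_mpolyC.
  rewrite rmorph_prod [RHS](reindex_inj (@perm_inj _ g.2)); apply: eq_bigr => k _ /=.
  rewrite rmorphB /= map_polyXn map_polyC /=; congr (_ - _%:P).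
  rewrite /signed_act rmorphXn /= comp_mpolyXU -tnth_nth tnth_mktuple.
  by rewrite exprZn sqrr_sign scale1r.
move=> _ [m [c [h [hg ->]]]]; rewrite rmorph_sum; elim/big_ind: _ => // l _.
rewrite (rmorphM (signed_act g)); apply: IM; have [k _ <-] := hg l.
by rewrite -(coef_map (signed_act g)) gen.
Qed.

Let odd_power (k : nat) (x : B) : B := if odd k then x ^+ k else 0.

Let J : B := \det (\matrix_(r < n, l < n) (eta l ^+ r.*2.+1 *+ 2)).

(* Summing over the signs kills the monomials with an even exponent; the sum over
   permutations is then a determinant, whose rows are reduced modulo [p(u^2)]. *)
Lemma split_alternate x :
  \sum_(g : signed) (\prod_k (-1) ^+ g.1 k * (-1) ^+ g.2) * q (signed_act g x) =
  J * i (top_functional p x).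
Proof.
elim/mpolyind: x => [|c m x _ _ IH].
  by rewrite big1 ?raddf0 ?mulr0 // => g _; rewrite !raddf0 mulr0.
under eq_bigr do rewrite (rmorphD (signed_act _)) rmorphD mulrDr.
have -> : top_functional p (c *: 'X_[m] + x) = c * top_monomial p m + top_functional p x.
  by rewrite linearP /= top_functionalX.
rewrite big_split IH (rmorphD i) mulrDr; congr (_ + _); rewrite {IH x}.
rewrite (rmorphM i) mulrCA -mul_mpolyC.
transitivity (i c * \sum_(g : signed)
   (\prod_k (-1) ^+ g.1 k * (-1) ^+ g.2) * \prod_k ((-1) ^+ g.1 k * eta (g.2 k)) ^+ m k).
  rewrite mulr_sumr; apply: eq_bigr => g _.
  rewrite rmorphM /= comp_mpolyC rmorphM mulrCA; congr (_ * (_ * _)).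
  rewrite comp_mpolyX rmorph_prod; apply: eq_bigr => k _.
  rewrite rmorphXn tnth_mktuple; congr (_ ^+ _).
  by rewrite -mul_mpolyC rmorphM !rmorph_sign.
congr (_ * _).
have e2 k (y : B) : \sum_(e : bool) (-1) ^+ e * ((-1) ^+ e * y) ^+ k = odd_power k y *+ 2.
  rewrite big_bool /= expr0 expr1 !mul1r !mulN1r exprNn -signr_odd /odd_power.
  by case: odd; rewrite ?expr0 ?expr1 ?mulN1r ?opprK ?mul1r ?addNr ?mul0rn -?mulr2n.
transitivity (\det (\matrix_(k, l) (odd_power (m k) (eta l) *+ 2))).
  rewrite -(pair_bigA _ (fun (e : {ffun 'I_n -> bool}) (s : 'S_n) =>
    (\prod_k (-1) ^+ e k * (-1) ^+ s) * \prod_k ((-1) ^+ e k * eta (s k)) ^+ m k)) /=.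
  rewrite exchange_big; apply: eq_bigr => s _ /=.
  transitivity ((-1) ^+ s *
      \prod_k \sum_(e : bool) (-1) ^+ e * ((-1) ^+ e * eta (s k)) ^+ m k).
    rewrite bigA_distr_bigA mulr_sumr; apply: eq_bigr => e _.
    by rewrite big_split mulrCA mulrA; congr (_ * _).
  by congr (_ * _); apply: eq_bigr => k _; rewrite e2 mxE.
rewrite /top_monomial -det_map_mx /J mulrC -det_mulmx; congr (\det _).
apply/matrixP => k l; rewrite !mxE.
have px : (map_poly i p).[eta l ^+ 2] = 0.
  have := congr1 (horner ^~ (eta l)) factor.
  rewrite horner_comp hornerXn => ->.
  by rewrite horner_prod (bigD1 l) //= hornerD hornerN hornerXn hornerC subrr mul0r.
rewrite /odd_power -(odd_residue_eval (monic_map i mon_p) size_ip (m k) n_gt0 px).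
rewrite -sumrMnl; apply: eq_bigr => r _.
by rewrite !mxE -map_odd_residue mxE mulrnAr.
Qed.

(** The functional recovers [c] from [c] times the kernel. *)
Lemma split_inj : injective i.
Proof.
apply: raddf_inj => c /q_eq0 Ic; have [_ _ IM] := idealP (ssplit_ideal n (p \Po 'X^2)).
have /(top_functional_ideal mon_p size_p) := IM (reproducing_kernel (fun _ : 'I_n => 0)) _ Ic.
by rewrite mulrC top_functionalCM top_functional_kernel // mulr1.
Qed.

Lemma split_roots : map_poly i p = \prod_(k < n) ('X - (eta k ^+ 2)%:P).
Proof.
have : map_poly i p \Po 'X^2 = (\prod_(k < n) ('X - (eta k ^+ 2)%:P)) \Po 'X^2.
  rewrite factor rmorph_prod; apply: eq_bigr => k _ /=.
  by rewrite comp_polyB comp_polyX comp_polyC.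
move=> e; apply/polyP => k; have := congr1 (fun r : {poly B} => r`_(k * 2)) e.
by rewrite !coef_comp_poly_Xn // dvdn_mull // mulnK.
Qed.

(** [J] is the Vandermonde determinant of the [eta k ^+ 2] times the product of the [2 eta k]. *)
Lemma split_J2 : J ^+ 2 = i ((-1) ^+ n * 4 ^+ n * p`_0 * disc_monic p).
Proof.
have -> : J = (\prod_(k < n) \prod_(l < n | (k < l)%N) (eta l ^+ 2 - eta k ^+ 2)) *
    \prod_(k < n) (eta k *+ 2).
  transitivity (\det (Vandermonde n (\row_k eta k ^+ 2) *m diag_mx (\row_k (eta k *+ 2)))).
    congr (\det _); apply/matrixP => r l; rewrite mul_mx_diag !mxE -exprM.
    by rewrite mulrnAr -exprSr mul2n.
  rewrite det_mulmx det_Vandermonde det_diag; congr (_ * _).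
    by apply: eq_bigr => k _; apply: eq_bigr => l _; rewrite !mxE.
  by apply: eq_bigr => k _; rewrite mxE.
have disc : i (disc_monic p) =
    (\prod_(k < n) \prod_(l < n | (k < l)%N) (eta l ^+ 2 - eta k ^+ 2)) ^+ 2.
  rewrite -disc_monic_roots -split_roots /disc_monic rmorphM rmorphXn rmorphN rmorph1.
  rewrite size_ip size_p deriv_map; congr (_ * _).
  (* Injectivity of [i] preserves the size of the derivative, whatever its degree, so Sylvester
     matrices map to Sylvester matrices. *)
  rewrite /resultant /Sylvester_mx !(size_map_inj_poly split_inj (rmorph0 i)).
  rewrite -det_map_mx map_col_mx; congr (\det (col_mx _ _));
    by apply: map_lin1_mx => v; rewrite map_poly_rV rmorphM /= map_rVpoly.
have p0 : i p`_0 = (-1) ^+ n * \prod_(k < n) eta k ^+ 2.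
  rewrite -coef_map -horner_coef0 split_roots horner_prod.
  under eq_bigr do rewrite !hornerE.
  by rewrite prodrN card_ord.
have sq2 : (\prod_(k < n) (eta k *+ 2)) ^+ 2 = 4 ^+ n * \prod_(k < n) eta k ^+ 2.
  rewrite -prodrXl; under eq_bigr do rewrite exprMn_n -mulr_natl.
  by rewrite big_split /= prodr_const card_ord.
rewrite (rmorphM i) disc !(rmorphM i) p0 exprMn sq2.
rewrite !(rmorphXn i) rmorphN rmorph1 rmorph_nat.
transitivity (((-1) ^+ n * (-1) ^+ n) * (4 ^+ n * \prod_(k < n) eta k ^+ 2 *
  (\prod_(k < n) \prod_(l < n | (k < l)%N) (eta l ^+ 2 - eta k ^+ 2)) ^+ 2)); last by ring.
by rewrite -expr2 sqrr_sign mul1r mulrC.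
Qed.

Theorem split_normal_domain : noetherian A -> normal_ring A ->
  let D := (-1) ^+ n * 4 ^+ n * p`_0 * disc_monic p in
  nonzerodiv D -> codim_ge (Vsing D) 2 -> normal_ring B.
Proof.
move=> hA nA D nzD codD Q.
have [T TE] := split_functional.
have [I [b [b' dual]]] := split_dual_basis TE.
have /choice[act actE] : forall g : signed, exists psi : {rmorphism B -> B},
    forall x, psi (q x) = q (signed_act g x).
  by move=> g; apply: quotient_endomorphism => // x; apply: signed_act_ideal.
apply: (@frobenius_normal_domain A B i T I b b' (q (reproducing_kernel (fun _ : 'I_n => 0)))
  _ dual _ signed act (fun g => \prod_k (-1) ^+ g.1 k * (-1) ^+ g.2) J D) => //.
- move=> c y; have [x <-] := q_surj y.
  by rewrite -[i c]/(q c%:MP) -rmorphM !TE top_functionalCM.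
- by rewrite TE top_functional_kernel.
- by move=> g c; rewrite -[i c]/(q c%:MP) actE /signed_act /= comp_mpolyC.
- move=> y; have [x <-] := q_surj y; rewrite TE -split_alternate.
  by apply: eq_bigr => g _; rewrite actE.
- exact: split_J2.
Qed.

End Splitting.

Lemma ftilde_poly (A : comNzRingType) (n : nat) (a : nat -> A) :
  ftilde n a = \poly_(k < n.+1) a (2 * n - 2 * k)%N.
Proof. by rewrite poly_def. Qed.

Lemma size_ftilde (A : comNzRingType) (n : nat) (a : nat -> A) :
  a 0%N = 1 -> size (ftilde n a) = n.+1.
Proof. by move=> a0; rewrite ftilde_poly size_poly_eq //= subnn a0 oner_eq0. Qed.

Lemma ftilde_monic (A : comNzRingType) (n : nat) (a : nat -> A) :
  a 0%N = 1 -> ftilde n a \is monic.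
Proof.
move=> a0; rewrite monicE /lead_coef size_ftilde // ftilde_poly coef_poly /=.
by rewrite ltnSn subnn a0.
Qed.

Lemma fpolyE (A : comNzRingType) (n : nat) (a : nat -> A) :
  fpoly n a = ftilde n a \Po 'X^2.
Proof.
rewrite /fpoly /ftilde linear_sum; apply: eq_bigr => k _.
by rewrite linearZ /= comp_Xn_poly -exprM.
Qed.

Theorem proposition2p7 (A : comNzRingType) (n : nat) (a : nat -> A)
    (hnoeth : noetherian A)
    (h2 : exists y : A, 2 * y = 1)
    (hn : (1 <= n)%N)
    (ha0 : a 0%N = 1)
    (hnormal : normal_ring A)
    (hnzd : nonzerodiv (Delta n a))
    (hcodim : codim_ge (Vsing (Delta n a)) 2) :
  squarefree (Delta n a) /\ normal_ring (SSplit n (fpoly n a)).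
Proof.
split; first exact: squarefree_codim2.
have mon_p := ftilde_monic n ha0; have size_p := size_ftilde n ha0.
have DE : Delta n a = (-1) ^+ n * 4 ^+ n * (ftilde n a)`_0 * disc_monic (ftilde n a).
  by rewrite /Delta; congr (_ * _ * _); rewrite ftilde_poly coef_poly /= muln0 subn0.
rewrite DE in hnzd hcodim; rewrite fpolyE.
pose I := ssplit_ideal n (ftilde n a \Po 'X^2).
pose B : comNzRingType := HB.pack (quotring I)
  (GRing.PzSemiRing_isNonZero.Build (quotring I) (SSplit_nonzero mon_p size_p)).
pose q : {rmorphism {mpoly A[n]} -> B} := qproj I.
exact: (@split_normal_domain A n (ftilde n a) B q hn mon_p size_p (@qproj_surj _ I)
  (@qproj_eq0 _ I) hnoeth hnormal hnzd hcodim).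
Qed.
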